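(* Let $n\ge 2$, $G=\mathrm{Spin}(2n,1)$, let $a_1>a_2>\cdots>a_{n-1}>|a_n|>0$ be real numbers, $\vec a=(a_1,\dots,a_n)$, $f=\iota(t_{\vec a})\in\mathfrak g^*$, and $\mathcal O_f=G\cdot f$. The moment map $q:\mathcal O_f\to\mathfrak p^*$ has image lying in the set of depth one elements. For any $g\in G$, the reduced space $q^{-1}(q(g\cdot f))/\mathrm{Stab}_P(q(g\cdot f))$ is a singleton. The moment map $q$ is weakly proper, but not proper.
   Context: Put $m=2n-1$. $G=\mathrm{Spin}(m+1,1)$ is the two-fold covering of $\mathrm{SO}_e(m+1,1)$, the identity component of $\{X\in M_{m+2}(\mathbb{R}):XI_{m+1,1}X^t=I_{m+1,1}\}$, $I_{m+1,1}=\mathrm{diag}(1,\dots,1,-1)$; $\mathfrak g=\mathfrak{so}(m+1,1)$. $H_0$ has only nonzero entries $1$ at positions $(m+1,m+2),(m+2,m+1)$; $\mathfrak a=\mathbb{R}H_0$; $\mathfrak m=\mathfrak{so}(m)$ (upper-left block); for a row vector $\alpha\in\mathbb{R}^m$, $X_\alpha=\begin{pmatrix}0_{m\times m}&-\alpha^t&\alpha^t\\ \alpha&0&0\\ \alpha&0&0\end{pmatrix}$ and $\mathfrak n=\{X_\alpha\}$. $P=MAN$ is the minimal parabolic subgroup with Lie algebra $\mathfrak p=\mathfrak l+\mathfrak n$, $\mathfrak l=\mathfrak m+\mathfrak a$, $M\cong\mathrm{Spin}(m)$. Put $H'=\begin{pmatrix}0&1\\-1&0\end{pmatrix}$ and $t_{\vec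 a}=\mathrm{diag}\{a_1H',\dots,a_nH',0\}\in\mathfrak g$. $\iota:\mathfrak g\to\mathfrak g^*$ is $\iota(X)(Y)=\frac12\mathrm{tr}(XY)$. The moment map $q:\mathcal O_f\to\mathfrak p^*$ is restriction of linear forms to $\mathfrak p$. An element of $\mathfrak p^*$ has depth zero if it lies in $\mathfrak l^*=\{h\in\mathfrak p^*:h|_{\mathfrak n}=0\}$, and depth one otherwise. An element $h\in\mathfrak p^*$ is regular if its coadjoint $P$-orbit has maximal dimension; it is strongly regular if it is regular and $\mathfrak s(h)=\{X\in\mathfrak p(h):\mathrm{ad}(X)\text{ is semisimple}\}$ ($\mathfrak p(h)$ the stabilizer of $h$ in $\mathfrak p$) has maximal dimension among all regular elements. $\Upsilon_{sr}\subset\mathfrak p^*$ is the set of strongly regular elements. $q$ is weakly proper if the preimage of each compact subset contained in $q(\mathcal O_f)\cap\Upsilon_{sr}$ is compact in $\mathcal O_f$. *)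

(* Defs.v *)
From HB Require Import structures.
From mathcomp Require Import all_boot all_order all_algebra.
From mathcomp Require Import all_classical all_reals all_analysis.

Set Implicit Arguments.
Unset Strict Implicit.
Unset Printing Implicit Defensive.

Import Order.TTheory GRing.Theory Num.Theory.
Import numFieldNormedType.Exports.

Local Open Scope classical_set_scope.
Local Open Scope ring_scope.

HB.mixin Record Group_isTopGroup G & Topological G & Group G := {
  mulg_continuous : continuous (fun x : G * G => (x.1 * x.2)%g) ;
  invg_continuous : continuous (fun x : G => (x^-1)%g)
}.

#[short(type="topGroupType")]
HB.structure Definition TopGroup :=
  {G of Topological G & Group G & Group_isTopGroup G}.

(* [p] maps [V] homeomorphically onto [W]; [s] is the inverse. *)
Definition homeo_onto (T U : topologicalType) (p : T -> U)
    (V : set T) (W : set U) : Prop :=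
  [/\ p @` V = W, {within V, continuous p} &
      exists s : U -> T,
        (forall x, V x -> s (p x) = x) /\ {within W, continuous s}].

(* The base [B] is a subspace of [U], so its open subsets are [B `&` W] with
   [W] open in [U]. *)
Definition two_fold_covering (T U : topologicalType) (B : set U) (p : T -> U)
    : Prop :=
  [/\ continuous p, (forall x, B (p x)) &
      forall y, B y -> exists W : set U,
        [/\ open W, W y &
            exists V0 V1 : set T,
              [/\ open V0 /\ open V1, V0 `&` V1 = set0, V0 `|` V1 = p @^-1` W,
                  homeo_onto p V0 (B `&` W) & homeo_onto p V1 (B `&` W)]]].

Definition dual (R : realType) (V : vectType R) := 'Hom(V, R^o).

(* [dual V] has the usual topology of a finite dimensional space, transported
   by these coordinates. *)
Definition dual_coord (R : realType) (V : vectType R) (h : dual V)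
    : 'rV[R]_(\dim {: V}) := \row_i h (vbasis {: V})`_i.

HB.instance Definition _ (R : realType) (V : vectType R) := Vector.on (dual V).
HB.instance Definition _ (R : realType) (V : vectType R) :=
  Topological.copy (dual V) (initial_topology (@dual_coord R V)).

(* The largest size of a free family in [S], i.e. the dimension of the linear
   span of [S]; this is the dimension of [S] whenever [S] is a subspace. *)
Definition set_dim (R : realType) (V : vectType R) (S : set V) : nat :=
  \max_(d < (\dim {: V}).+1 |
      `[< exists2 b : d.-tuple V, free b & forall x, x \in (b : seq V) -> S x >]) d.

Definition semisimple_end (R : realType) (V : vectType R) (phi : 'End(V))
    : Prop :=
  forall U : {vspace V}, (phi @: U <= U)%VS ->
  exists W : {vspace V},
    [/\ (phi @: W <= W)%VS, (U + W = fullv)%VS & (U :&: W = 0)%VS].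

Lemma linfunE (R : realType) (V W : vectType R) (f : V -> W) :
  linear f -> linfun f =1 f.
Proof.
move=> fL x.
pose F := GRing.isLinear.Build R V W _ f fL.
pose g : {linear V -> W} := HB.pack f F.
exact: (lfunE g x).
Qed.

(* [vsproj V] is the identity on [V]. In the definitions below it is only
   applied to elements of [V] as soon as [V] is a Lie subalgebra (for [lie]),
   stable under conjugation by [rho g] (for [Ad]). *)
Section MatrixLieAlgebra.
Context {R : realType} {N : nat}.
Implicit Types V : {vspace 'M[R]_N}.

Definition lie V (X Y : subvs_of V) : subvs_of V :=
  vsproj V (vsval X *m vsval Y - vsval Y *m vsval X).

Definition ad V (X : subvs_of V) : 'End(subvs_of V) := linfun (lie X).

(* Infinitesimal coadjoint action, [(X . h)(Y) = - h [X, Y]]. *)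
Definition coad V (X : subvs_of V) (h : dual (subvs_of V))
    : dual (subvs_of V) :=
  linfun (fun Y => - h (lie X Y) : R^o).

(* The stabilizer of [h] in the Lie algebra [V], and the tangent space at [h]
   of the coadjoint orbit of [h]. *)
Definition lie_stab V (h : dual (subvs_of V)) : {vspace subvs_of V} :=
  lker (linfun (fun X : subvs_of V => coad X h)).

Definition coad_tangent V (h : dual (subvs_of V))
    : {vspace dual (subvs_of V)} :=
  limg (linfun (fun X : subvs_of V => coad X h)).

Definition Ad (G : groupType) (rho : G -> 'M[R]_N) V (g : G) (X : subvs_of V)
    : subvs_of V :=
  vsproj V (rho g *m vsval X *m rho (g^-1)%g).

Definition coAd (G : groupType) (rho : G -> 'M[R]_N) V (g : G)
    (h : dual (subvs_of V)) : dual (subvs_of V) :=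
  linfun (fun X => h (Ad rho (g^-1)%g X)).

Lemma lie_linear V (X : subvs_of V) : linear (lie X).
Proof.
move=> a Y Z; rewrite /lie -linearP; congr (vsproj V _).
rewrite [vsval (_ + _)]linearP mulmxDr mulmxDl -scalemxAr -scalemxAl scalerBr.
by rewrite opprD !addrA; congr (_ - _); rewrite -!addrA; congr (_ + _); rewrite addrC.
Qed.

Lemma lieC V (X Y : subvs_of V) : lie X Y = - lie Y X.
Proof. by rewrite /lie -(raddfN (vsproj V)) opprB. Qed.

Lemma coadE V (X : subvs_of V) (h : dual (subvs_of V)) Y :
  coad X h Y = - h (lie X Y).
Proof.
apply: (@linfunE R (subvs_of V) R^o) => a Y1 Y2.
by rewrite lie_linear linearP opprD scalerN.
Qed.

Lemma coad_linear V (h : dual (subvs_of V)) :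
  linear (fun X : subvs_of V => coad X h).
Proof.
move=> a X Y; apply/lfunP => Z.
rewrite add_lfunE scale_lfunE !coadE ![lie _ Z]lieC !linearN /= !opprK.
by rewrite lie_linear linearP.
Qed.

Lemma coAdE (G : groupType) (rho : G -> 'M[R]_N) V (g : G)
    (h : dual (subvs_of V)) X : coAd rho g h X = h (Ad rho (g^-1)%g X).
Proof.
apply: (@linfunE R (subvs_of V) R^o) => a Y1 Y2; rewrite -linearP.
congr (h _); rewrite /Ad -linearP; congr (vsproj V _).
by rewrite [vsval (_ + _)]linearP mulmxDr mulmxDl -scalemxAr -scalemxAl.
Qed.

End MatrixLieAlgebra.

Section Lorentz.
Context (R : realType) (m : nat).
Local Notation N := (m + (1 + 1))%N.

Definition Imx : 'M[R]_N := diag_mx (\row_j (if (j < m.+1)%N then 1 else -1)).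

Definition Omx : set 'M[R]_N := [set X | X *m Imx *m X^T = Imx].
Definition SOe : set 'M[R]_N := connected_component Omx 1%:M.

Definition Xmx (alpha : 'rV[R]_m) : 'M[R]_N :=
  block_mx 0 (row_mx (- alpha^T) alpha^T) (col_mx alpha alpha) 0.

Definition H0 : 'M[R]_N := block_mx 0 0 0 (block_mx 0 1%:M 1%:M 0).

Definition so_defect (X : 'M[R]_N) : 'M[R]_N := X *m Imx + Imx *m X^T.
Definition so_lor : {vspace 'M[R]_N} := lker (linfun so_defect).

Definition skew : {vspace 'M[R]_m} := lker (linfun (fun B : 'M[R]_m => B + B^T)).
Definition upper_left (B : 'M[R]_m) : 'M[R]_N := block_mx B 0 0 0.

Definition lie_m : {vspace 'M[R]_N} := (linfun upper_left @: skew)%VS.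
Definition lie_a : {vspace 'M[R]_N} := <[H0]>%VS.
Definition lie_n : {vspace 'M[R]_N} := limg (linfun Xmx).
Definition lie_p : {vspace 'M[R]_N} := (lie_m + lie_a + lie_n)%VS.

(* The subgroups of [SO_e(m+1,1)] below [M], [A] and [N]: the upper-left
   [SO(m)], the elements [exp (t H0)], and the elements [exp (Xmx alpha)],
   where [Xmx alpha ^ 3 = 0]. *)
Definition M0 : set 'M[R]_N :=
  [set block_mx B 0 0 1%:M | B in [set B | B *m B^T = 1%:M /\ \det B = 1]].

Definition A0 : set 'M[R]_N :=
  [set block_mx 1%:M 0 0
         (block_mx ((expR t + expR (- t)) / 2)%:M ((expR t - expR (- t)) / 2)%:M
                   ((expR t - expR (- t)) / 2)%:M ((expR t + expR (- t)) / 2)%:M)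
  | t in [set: R]].

Definition N0 : set 'M[R]_N :=
  [set 1%:M + Xmx alpha + 2^-1 *: (Xmx alpha *m Xmx alpha)
  | alpha in [set: 'rV[R]_m]].

Definition iota_form (X : subvs_of so_lor) : dual (subvs_of so_lor) :=
  linfun (fun Y => 2^-1 * \tr (vsval X *m vsval Y) : R^o).

(* Restriction of linear forms from [so_lor] to [lie_p]; [vsproj] only
   changes the type, by [lie_p_sub]. *)
Definition moment (h : dual (subvs_of so_lor)) : dual (subvs_of lie_p) :=
  linfun (fun Y => h (vsproj so_lor (vsval Y))).

Definition depth_zero (h : dual (subvs_of lie_p)) : Prop :=
  forall X : subvs_of lie_p, vsval X \in lie_n -> h X = 0.
Definition depth_one (h : dual (subvs_of lie_p)) : Prop := ~ depth_zero h.

Definition regular (h : dual (subvs_of lie_p)) : Prop :=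
  forall h' : dual (subvs_of lie_p),
    (\dim (coad_tangent h') <= \dim (coad_tangent h))%N.

Definition lie_s (h : dual (subvs_of lie_p)) : set (subvs_of lie_p) :=
  [set X | X \in lie_stab h /\ semisimple_end (ad X)].

Definition strongly_regular (h : dual (subvs_of lie_p)) : Prop :=
  regular h /\
  forall h', regular h' -> (set_dim (lie_s h') <= set_dim (lie_s h))%N.

(* [Spin(m+1,1)], with its projection [rho] to [SO_e(m+1,1)]. The connected
   two-fold covering group is unique up to isomorphism for [m >= 2], since
   [SO_e(m+1,1)] then has fundamental group of order 2. *)
Definition is_spin (G : topGroupType) (rho : G -> 'M[R]_N) : Prop :=
  [/\ connected [set: G],
      (forall x y : G, rho (x * y)%g = rho x *m rho y) &
      two_fold_covering SOe rho].

Section Spin.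
Context (G : topGroupType) (rho : G -> 'M[R]_N).

(* [P = MAN]; since [M] contains the kernel of [rho], this is the full preimage
   of [M0 A0 N0]. *)
Definition parabolic : set G :=
  [set g | exists x y z, [/\ M0 x, A0 y, N0 z & rho g = x *m y *m z]].

Definition coad_orbit (f : dual (subvs_of so_lor))
    : set (dual (subvs_of so_lor)) := range (fun g : G => coAd rho g f).

Definition stab_P (h : dual (subvs_of lie_p)) : set G :=
  [set p | parabolic p /\ coAd rho p h = h].

(* [preimage_q f A] is the preimage of [A] under the moment map
   [q : coad_orbit f -> p^*]. *)
Definition preimage_q (f : dual (subvs_of so_lor))
    (A : set (dual (subvs_of lie_p))) : set (dual (subvs_of so_lor)) :=
  coad_orbit f `&` moment @^-1` A.

(* The quotient [q^-1(h) / Stab_P(h)], as the set of [Stab_P(h)]-orbits. *)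
Definition reduced_space (f : dual (subvs_of so_lor))
    (h : dual (subvs_of lie_p)) : set (set (dual (subvs_of so_lor))) :=
  [set [set coAd rho p x | p in stab_P h] | x in preimage_q f [set h]].

Definition q_proper (f : dual (subvs_of so_lor)) : Prop :=
  forall K, compact K -> compact (preimage_q f K).

Definition q_weakly_proper (f : dual (subvs_of so_lor)) : Prop :=
  forall K, compact K ->
    K `<=` moment @` coad_orbit f `&` [set h | strongly_regular h] ->
    compact (preimage_q f K).

End Spin.

Lemma so_lorE X : (X \in so_lor) = (X *m Imx + Imx *m X^T == 0).
Proof.
rewrite memv_ker linfunE // => a Y Z; rewrite /so_defect mulmxDl linearP /=.
by rewrite mulmxDr -scalemxAl -scalemxAr scalerDr !addrA; congr (_ + _); rewrite -!addrA; congr (_ + _); rewrite addrC.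
Qed.

Lemma ImxE : Imx = block_mx 1%:M 0 0 (block_mx 1%:M 0 0 (-1)%:M).
Proof.
apply/matrixP => i j; rewrite [LHS]mxE mxE.
case: (split_ordP i) => i' ->; case: (split_ordP j) => j' ->.
- by rewrite block_mxEul mxE eq_lshift /= leqW ?ltn_ord.
- by rewrite block_mxEur mxE eq_lrshift.
- by rewrite block_mxEdl mxE eq_rlshift.
rewrite block_mxEdr eq_rshift /= -[X in (_ < X)%N]addn1 ltn_add2l.
by case: (split_ordP i') => i'' ->; case: (split_ordP j') => j'' ->;
  rewrite !ord1 (block_mxEul, block_mxEur, block_mxEdl, block_mxEdr) mxE -val_eqE.
Qed.

Lemma upper_left_linear : linear upper_left.
Proof.
by move=> a B C; rewrite /upper_left scale_block_mx !scaler0 add_block_mx !addr0.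
Qed.

Lemma Xmx_linear : linear Xmx.
Proof.
move=> a B C; rewrite /Xmx scale_block_mx !scaler0 add_block_mx !addr0.
rewrite scale_row_mx scale_col_mx add_row_mx add_col_mx.
by rewrite [(_ + _)^T]linearP /= scalerN opprD.
Qed.

Lemma lie_p_sub : (lie_p <= so_lor)%VS.
Proof.
rewrite /lie_p !subv_add -memvE; apply/andP; split; first apply/andP; last first.
- apply/subvP => _ /memv_imgP[al _ ->]; rewrite (linfunE Xmx_linear) so_lorE ImxE.
  rewrite /Xmx tr_block_mx !mulmx_block !trmx0 tr_row_mx tr_col_mx.
  rewrite !(mul0mx, mulmx0, mul1mx, mulmx1, addr0, add0r).
  rewrite mul_row_block mul_block_col !(mul0mx, mulmx0, mul1mx, mulmx1, addr0, add0r).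
  rewrite linearN /= trmxK !mul_mx_scalar !mul_scalar_mx !scaleN1r.
  rewrite add_block_mx add_row_mx add_col_mx !addNr !addrN !addr0.
  by rewrite row_mx0 col_mx0 block_mx_eq0 !eqxx.
split.
- apply/subvP => _ /memv_imgP[B + ->]; rewrite memv_ker linfunE; last first.
    by move=> a C D; rewrite linearP /= scalerDr !addrA; congr (_ + _);
       rewrite -!addrA; congr (_ + _); rewrite addrC.
  move=> /eqP BT; rewrite (linfunE upper_left_linear) so_lorE ImxE /upper_left.
  rewrite tr_block_mx !mulmx_block !trmx0 !(mul0mx, mulmx0, mul1mx, mulmx1, addr0, add0r).
  by rewrite add_block_mx BT !addr0 block_mx_eq0 !eqxx.
- rewrite so_lorE ImxE /H0 !tr_block_mx !mulmx_block !trmx0 !trmx1.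
  rewrite !(mul0mx, mulmx0, mul1mx, mulmx1, addr0, add0r).
  by rewrite !add_block_mx !addr0 raddfN /= addNr addrN !block_mx_eq0 !eqxx.
Qed.

Lemma iota_formE X Y : iota_form X Y = 2^-1 * \tr (vsval X *m vsval Y).
Proof.
apply: (@linfunE R (subvs_of so_lor) R^o) => a Y1 Y2.
rewrite [vsval (_ + _)]linearP mulmxDr -scalemxAr mxtraceD mxtraceZ mulrDr.
congr (_ + _); exact: mulrCA.
Qed.

Lemma momentE h (Y : subvs_of lie_p) :
  moment h Y = h (vsproj so_lor (vsval Y)).
Proof.
apply: (@linfunE R (subvs_of lie_p) R^o) => a Y1 Y2.
by rewrite !linearP.
Qed.

End Lorentz.

Arguments moment {R m} h.

(* [diag {a_1 H', ..., a_n H', 0}], with 0-based indices: the entries at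
   [(2k, 2k+1)] and [(2k+1, 2k)] are [a k] and [- a k]. *)
Definition t_mx (R : realType) (n m : nat) (a : 'I_n -> R)
    : 'M[R]_(m + (1 + 1)) :=
  \matrix_(i, j) \sum_(k < n)
    a k * (((i == k.*2 :> nat) && (j == k.*2.+1 :> nat))%:R
           - ((i == k.*2.+1 :> nat) && (j == k.*2 :> nat))%:R).

Lemma t_mx_so (R : realType) (n m : nat) (a : 'I_n -> R) :
  (n.*2 <= m.+1)%N -> t_mx m a \in so_lor R m.
Proof.
move=> nm; rewrite so_lorE; apply/eqP/matrixP => i j.
rewrite mul_mx_diag mul_diag_mx !mxE mulr_suml mulr_sumr -big_split /=.
apply: big1 => k _.
have k1 : (k.*2.+1 < m.+1)%N by rewrite (leq_trans _ nm) // -doubleS leq_double.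
have k0 : (k.*2 < m.+1)%N by apply: ltn_trans k1.
rewrite [(j == _.+1 :> nat) && _]andbC [(j == _ :> nat) && _]andbC.
case: (boolP ((i == k.*2 :> nat) && _)) => [/andP[/eqP -> /eqP ->]|_].
  by rewrite k0 k1 mulr1 mul1r -mulrDr -[X in _ + X]opprB subrr mulr0.
case: (boolP ((i == k.*2.+1 :> nat) && _)) => [/andP[/eqP -> /eqP ->]|_].
  by rewrite k0 k1 mulr1 mul1r -mulrDr -[X in _ + X]opprB subrr mulr0.
by rewrite subrr mulr0 mul0r mulr0 addr0.
Qed.

Definition f_elt (R : realType) (n m : nat) (a : 'I_n -> R)
    : dual (subvs_of (so_lor R m)) :=
  iota_form (vsproj (so_lor R m) (t_mx m a)).

(* Main.v *)
Require Import Defs.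
From HB Require Import structures.
From mathcomp Require Import all_boot all_order all_algebra.
From mathcomp Require Import all_classical all_reals all_analysis.
From mathcomp Require Import ring lra zify.

Set Implicit Arguments.
Unset Strict Implicit.
Unset Printing Implicit Defensive.

Import Order.TTheory GRing.Theory Num.Theory.
Import numFieldNormedType.Exports.

Local Open Scope classical_set_scope.
Local Open Scope ring_scope.

(** Write [J] for the Lorentz metric, [v = (0, .., 0, 1, 1)] for the null vector
    whose line is fixed by [P], [t] for the matrix of [f], and [X = g t g^-1] for
    a point of the orbit. The trace form identifies the restriction of [iota X]
    to [p] with the class of [X] modulo [n], since [n] is the orthogonal of [p]
    ([lie_p_perp]). Everything is read off the null vector [w = g^-1 v].

    _Depth one_. Up to a constant factor, the [nbar]-component of [X] is the
    spatial part of [X v], whose squared length is [<X v, X v> = <t w, t w>], a sum of the [a_k ^ 2] weighted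
    by the squared radii [r_k] of [w] in the planes of [t] ([beta_sqr]). As [w]
    is null and nonzero, and no [a_k] vanishes, this is positive
    ([radius_bounds]), whereas it is zero on depth zero elements.

    _Reduced spaces_. Suppose [X' = g' t g'^-1] and [X] agree modulo [n]. An
    element of [n] is the rank two matrix [v a^* - a v^*], with stars for
    adjoints, so that adding it to [X] is a row and column operation on the
    bordered matrix with blocks [l - X], [v], [v^*], [0] ([bordered_Xmx]).
    Its determinant is, up to sign, the characteristic polynomial of [t] times the
    resolvent coefficient [<w, (l - t)^-1 w>]. Divided by [l], this has a partial
    fraction expansion in [l ^ 2] with the [r_k] as residues at the [- a_k ^ 2],
    which are distinct. Hence [w] and [w' = g'^-1 v] have the same radii
    ([radii_determined]), and a rotation [tau] commuting with [t] carries [w] to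
    [w'] ([rot_transitive]). Then [g' tau g^-1] carries [X] to [X'] and fixes
    [v], so it lies in [M N] ([fix_vnull]). So the fibres of the moment map are
    single orbits of the stabilizers in [P].

    _Weak properness_. Let [K] be a compact part of the image. On [K] the length
    of the [nbar]-component is bounded away from zero and from infinity; this
    confines the last coordinate of [w]. The numbers [<X v, X e_j>] also
    depend only on the moment image, and they control the last row of [g^-1],
    which controls all of [g] ([boundedness]). So the preimage of [K] is the
    image of a closed bounded set of matrices [g].

    _Failure of properness_. Conjugating [t] by the boosts [exp (u H0)]
    multiplies its [nbar]-component by [exp (- u)] and its [n]-component by
    [exp u]. The moment images stay in a segment, while the conjugates are
    unbounded ([not_proper]). *)

(** * Continuity, compactness and connectedness *)

Section Topology.
Context {R : realType}.

Lemma sum_continuous (T : topologicalType) (I : finType) (P : pred I)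
    (F : I -> T -> R) :
  (forall i, P i -> continuous (F i)) ->
  continuous (fun x => \sum_(i | P i) F i x).
Proof. by move=> Fc; apply: (@continuous_big R) => //; exact: (@add_continuous R^o). Qed.

Lemma prod_continuous (T : topologicalType) (I : finType) (P : pred I)
    (F : I -> T -> R) :
  (forall i, P i -> continuous (F i)) ->
  continuous (fun x => \prod_(i | P i) F i x).
Proof. by move=> Fc; apply: (@continuous_big R) => //; exact: mul_continuous. Qed.

Lemma mulr_fun_continuous (T : topologicalType) (f g : T -> R) :
  continuous f -> continuous g -> continuous (fun x => f x * g x).
Proof. by move=> fc gc x; apply: cvgM; [exact: fc | exact: gc]. Qed.

Lemma subr_fun_continuous (T : topologicalType) (f g : T -> R) :
  continuous f -> continuous g -> continuous (fun x => f x - g x).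
Proof. by move=> fc gc x; apply: cvgB; [exact: fc | exact: gc]. Qed.

Lemma invr_fun_continuous_at (T : topologicalType) (f : T -> R) x :
  f x != 0 -> {for x, continuous f} -> {for x, continuous (fun y => (f y)^-1)}.
Proof. by move=> fx fc; apply: cvgV. Qed.

Lemma entry_continuous (T : topologicalType) p q (f : T -> 'M[R]_(p, q)) i j :
  continuous f -> continuous (fun x => f x i j).
Proof.
move=> fc x; apply: (@continuous_comp _ _ _ f (fun M => M i j)).
  exact: fc.
exact: coord_continuous.
Qed.

Lemma mx_continuous (T : topologicalType) p q (f : T -> 'M[R]_(p, q)) :
  (forall i j, continuous (fun x => f x i j)) -> continuous f.
Proof.
move=> fc x A [P Pnbhs PA]; rewrite nbhs_simpl.
have : \forall y \near x, forall i j, P i j (f y i j).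
  apply: filter_forall => i; apply: filter_forall => j.
  exact: (fc i j x _ (Pnbhs i j)).
by apply: filterS => y /PA.
Qed.

(** The topology of [dual V] is that of pointwise convergence; this and the next
    lemma make the coordinates of its definition disappear. *)
Lemma dual_continuous (T : topologicalType) (V : vectType R)
    (f : T -> dual V) :
  (forall Y, continuous (fun x => f x Y : R)) -> continuous f.
Proof.
move=> fc.
apply: (@continuous_comp_initial (dual V) T _ (@dual_coord R V) f).
apply: mx_continuous => i j /=.
have -> : (fun x => dual_coord (f x) i j) =
          (fun x => f x (vbasis {: V})`_j : R) by apply/funext => x; rewrite mxE.
exact: fc.
Qed.

Lemma eval_continuous (V : vectType R) (Y : V) :
  continuous (fun h : dual V => h Y : R).
Proof.
have -> : (fun h : dual V => h Y : R) = (fun h => \sum_i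
    coord (vbasis {: V}) i Y * dual_coord h 0 i).
  apply/funext => h; rewrite {1}(coord_vbasis (memvf Y)) linear_sum /=.
  by apply: eq_bigr => i _; rewrite linearZ mxE.
apply: sum_continuous => i _.
apply: mulr_fun_continuous; first exact: cst_continuous.
apply: (@entry_continuous (dual V) _ _ (@dual_coord R V)).
exact: (@initial_continuous _ _ (@dual_coord R V)).
Qed.

Lemma dual_hausdorff (V : vectType R) : hausdorff_space (dual V).
Proof.
move=> p q pq; apply/lfunP => Y; apply: (@Rhausdorff R) => A B pA qB.
have [h [hA hB]] := pq _ _ (eval_continuous pA) (eval_continuous qB).
by exists (h Y).
Qed.

Lemma mx_box_compact p q (M : R) :
  compact [set A : 'M[R]_(p, q) | forall i j, `|A i j| <= M].
Proof.
have vc : continuous (vec_mx : 'rV[R]_(p * q) -> 'M[R]_(p, q)).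
  apply: mx_continuous => i j.
  have -> : (fun x : 'rV[R]_(p * q) => vec_mx x i j) =
            (fun x : 'rV[R]_(p * q) => x 0 (mxvec_index i j)).
    by apply/funext => x; rewrite mxE.
  exact: coord_continuous.
have -> : [set A : 'M[R]_(p, q) | forall i j, `|A i j| <= M] =
    vec_mx @` [set u : 'rV[R]_(p * q) | forall k, `[- M, M]%classic (u 0 k)].
  apply/seteqP; split => [A AM|_ [u uM <-] i j].
    exists (mxvec A); last exact: mxvecK.
    by move=> k; case/mxvec_indexP: k => i j; rewrite /= mxvecE in_itv /= -ler_norml.
  by have := uM (mxvec_index i j); rewrite mxE /= in_itv /= -ler_norml.
apply: continuous_compact; first exact: continuous_subspaceT.
apply: (@rV_compact _ _ (fun=> `[- M, M]%classic)) => _; exact: segment_compact.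
Qed.

Lemma mulmx_continuous (T : topologicalType) p q r
    (f : T -> 'M[R]_(p, q)) (g : T -> 'M[R]_(q, r)) :
  continuous f -> continuous g -> continuous (fun x => f x *m g x).
Proof.
move=> fc gc; apply: mx_continuous => i j.
have -> : (fun x => (f x *m g x) i j) = (fun x => \sum_k f x i k * g x k j).
  by apply/funext => x; rewrite mxE.
apply: sum_continuous => k _; by apply: mulr_fun_continuous; exact: entry_continuous.
Qed.

Lemma trmx_continuous (T : topologicalType) p q (f : T -> 'M[R]_(p, q)) :
  continuous f -> continuous (fun x => (f x)^T).
Proof.
move=> fc; apply: mx_continuous => i j.
have -> : (fun x => (f x)^T i j) = (fun x => f x j i).
  by apply/funext => x; rewrite mxE.
exact: entry_continuous.
Qed.

Lemma det_continuous p : continuous (fun A : 'M[R]_p => \det A).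
Proof.
apply: sum_continuous => s _; apply: mulr_fun_continuous.
  exact: cst_continuous.
by apply: prod_continuous => i _; exact: coord_continuous.
Qed.

Lemma mxtrace_continuous (T : topologicalType) p (f : T -> 'M[R]_p) :
  continuous f -> continuous (fun x => \tr (f x)).
Proof.
move=> fc; apply: sum_continuous => i _; exact: entry_continuous.
Qed.

Lemma connected_pos (T : topologicalType) (A : set T) (f : T -> R) x y :
  continuous f -> connected A -> (forall z, A z -> f z != 0) ->
  A x -> A y -> 0 < f x -> 0 < f y.
Proof.
move=> fc Ac f0 Ax Ay fx; rewrite ltNge; apply/negP => fy.
have /connected_intervalP : connected (f @` A).
  by apply: connected_continuous_connected => //; exact: continuous_subspaceT.
move=> /(_ (f y) (f x)) /(_ (imageP _ Ay) (imageP _ Ax) 0).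
by rewrite fy ltW // => /(_ isT) [z Az fz]; have := f0 z Az; rewrite fz eqxx.
Qed.

Lemma connected_component_range (T : topologicalType) (A : set T) (x : T)
    (f : R -> T) :
  continuous f -> f 0 = x -> (forall u, A (f u)) ->
  forall u, connected_component A x (f u).
Proof.
move=> fc f0 Af u; apply: (@connected_component_max _ A (range f)); last first.
- by exists u.
- apply: connected_continuous_connected; last exact: continuous_subspaceT.
  by apply/connected_intervalP.
- by move=> _ [v _ <-].
- by exists 0.
Qed.

End Topology.

(** * The Lorentz form and its Lie algebra *)

Section LorentzAlgebra.
Context {R : realType} {m : nat}.
Local Notation N := (m + (1 + 1))%N.
Local Notation J := (Imx R m).
Local Notation so := (so_lor R m).
Implicit Types (A g : 'M[R]_N) (B : 'M[R]_m) (al : 'rV[R]_m).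

(** The diagonal entries of [J]. *)
Definition msign (i : 'I_N) : R := if (i < m.+1)%N then 1 else -1.
(** Indices are split into [m] spatial ones, and the two spanning the plane of
    [H0]: the spacelike [iprev] and the timelike [ilast]. *)
Definition spa (j : 'I_m) : 'I_N := lshift (1 + 1) j.
Definition iprev : 'I_N := rshift m (lshift 1 ord0).
Definition ilast : 'I_N := rshift m (rshift 1 ord0).

Lemma indexP (i : 'I_N) : [\/ exists j, i = spa j, i = iprev | i = ilast].
Proof.
case: (split_ordP i) => j ->; first by constructor 1; exists j.
case: (split_ordP j) => k ->; rewrite ord1; first by constructor 2.
by constructor 3.
Qed.

Lemma sum_index (F : 'I_N -> R) :
  \sum_i F i = \sum_(j < m) F (spa j) + F iprev + F ilast.
Proof. by rewrite big_split_ord /= big_split_ord /= !big_ord1 addrA. Qed.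

(* Unlike [mxE], these leave matrices given by definitions folded. *)
Lemma addmxE p q (A B : 'M[R]_(p, q)) i j : (A + B) i j = A i j + B i j.
Proof. exact: mxE. Qed.

Lemma oppmxE p q (A : 'M[R]_(p, q)) i j : (- A) i j = - A i j.
Proof. exact: mxE. Qed.

Lemma trmxE p q (A : 'M[R]_(p, q)) i j : A^T i j = A j i.
Proof. exact: mxE. Qed.

Lemma scalemxE p q (A : 'M[R]_(p, q)) c i j : (c *: A) i j = c * A i j.
Proof. exact: mxE. Qed.

Lemma mulmxEs p q r (A : 'M[R]_(p, q)) (B : 'M[R]_(q, r)) i j :
  (A *m B) i j = \sum_k A i k * B k j.
Proof. exact: mxE. Qed.

Lemma msign_spa j : msign (spa j) = 1.
Proof. by rewrite /msign /= leqW. Qed.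

Lemma msign_prev : msign iprev = 1.
Proof. by rewrite /msign /= addn0 ltnSn. Qed.

Lemma msign_last : msign ilast = -1.
Proof. by rewrite /msign /= addn1 ltnn. Qed.

Lemma msign_sqr i : msign i * msign i = 1.
Proof. by rewrite /msign; case: ifP; rewrite ?mulrNN mulr1. Qed.

Lemma msign_neq0 i : msign i != 0.
Proof. by rewrite /msign; case: ifP; rewrite ?oppr_eq0 oner_eq0. Qed.

Lemma mulmx_Imx p (A : 'M[R]_(p, N)) i j : (A *m J) i j = A i j * msign j.
Proof. by rewrite mul_mx_diag !mxE. Qed.

Lemma Imx_mulmx p (A : 'M[R]_(N, p)) i j : (J *m A) i j = msign i * A i j.
Proof. by rewrite mul_diag_mx !mxE. Qed.

Lemma Imx_sqr : J *m J = 1%:M.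
Proof.
apply/matrixP => i j; rewrite Imx_mulmx !mxE; case: eqP => [->|_].
  by rewrite !mulr1n msign_sqr.
by rewrite !mulr0n mulr0.
Qed.

Lemma trmx_Imx : J^T = J. Proof. exact: tr_diag_mx. Qed.

Definition form (x y : 'cV[R]_N) : R := \sum_i msign i * x i 0 * y i 0.

Lemma formE x y : form x y = (x^T *m J *m y) 0 0.
Proof. by rewrite mxE; apply: eq_bigr => i _; rewrite mulmx_Imx mxE [x _ _ * _]mulrC. Qed.

Lemma formC x y : form x y = form y x.
Proof. by apply: eq_bigr => i _; rewrite mulrAC. Qed.

Lemma formDl x y z : form (x + y) z = form x z + form y z.
Proof. by rewrite -big_split; apply: eq_bigr => i _; rewrite mxE /=; ring. Qed.

Lemma formZl c x y : form (c *: x) y = c * form x y.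
Proof. by rewrite mulr_sumr; apply: eq_bigr => i _; rewrite mxE /=; ring. Qed.

Lemma formDr x y z : form x (y + z) = form x y + form x z.
Proof. by rewrite formC formDl !(formC x). Qed.

Lemma formZr c x y : form x (c *: y) = c * form x y.
Proof. by rewrite formC formZl formC. Qed.

(** The adjoint for the Lorentz form, which is the inverse on [Omx]. *)
Definition ginv (g : 'M[R]_N) : 'M[R]_N :=
  \matrix_(i, j) (msign i * msign j * g j i).

Lemma ginvE g i j : ginv g i j = msign i * msign j * g j i.
Proof. exact: mxE. Qed.

Lemma ginv_def g : ginv g = J *m g^T *m J.
Proof.
by apply/matrixP => i j; rewrite ginvE mulmx_Imx Imx_mulmx mxE mulrAC.
Qed.

Lemma mul_ginv g : Omx g -> g *m ginv g = 1%:M.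
Proof. by rewrite /Omx /= ginv_def !mulmxA => ->; exact: Imx_sqr. Qed.

Lemma ginv_mul g : Omx g -> ginv g *m g = 1%:M.
Proof. by move=> /mul_ginv /mulmx1C. Qed.

Lemma Omx_trmx g : Omx g -> g^T *m J *m g = J.
Proof.
move=> /ginv_mul h; have : J *m (ginv g *m g) = J by rewrite h mulmx1.
by rewrite ginv_def !mulmxA Imx_sqr mul1mx.
Qed.

Lemma form_Omx g x y : Omx g -> form (g *m x) (g *m y) = form x y.
Proof.
move=> gO; rewrite !formE trmx_mul -!mulmxA.
by rewrite [g^T *m _]mulmxA [_ *m (g *m y)]mulmxA Omx_trmx // mulmxA.
Qed.

Lemma so_lorP A :
  reflect (forall i j, A j i = - (msign i * msign j * A i j)) (A \in so).
Proof.
rewrite so_lorE; apply: (iffP eqP) => [/matrixP h i j|h].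
  have := h i j; rewrite mxE mulmx_Imx Imx_mulmx !mxE => hij.
  have := msign_sqr i; have := msign_sqr j => hj hi.
  have -> : A j i = msign i * (msign i * A j i) by rewrite mulrA hi mul1r.
  by rewrite [msign i * A j i](_ : _ = - (A i j * msign j)); [ring | lra].
apply/matrixP => i j; rewrite mxE mulmx_Imx Imx_mulmx !mxE (h i j).
have hi := msign_sqr i.
by rewrite mulrN !mulrA hi mul1r [msign j * _]mulrC subrr.
Qed.

Lemma form_so A x y : A \in so -> form (A *m x) y = - form x (A *m y).
Proof.
rewrite so_lorE => /eqP h.
have hA : A^T *m J = - (J *m A).
  apply/eqP; rewrite -addr_eq0; apply/eqP.
  have : J *m (A *m J + J *m A^T) *m J = 0 by rewrite h mulmx0 mul0mx.
  by rewrite mulmxDr mulmxDl !mulmxA Imx_sqr mul1mx -mulmxA Imx_sqr mulmx1 addrC.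
by rewrite !formE trmx_mul -[x^T *m A^T *m J]mulmxA hA mulmxN mulNmx mxE !mulmxA.
Qed.

Lemma conj_so A g : Omx g -> A \in so -> g *m A *m ginv g \in so.
Proof.
move=> gO; rewrite !so_lorE => /eqP h; apply/eqP.
have hJ : J *m A^T = - (A *m J) by apply/eqP; rewrite -addr_eq0 addrC h.
have -> : g *m A *m ginv g *m J = g *m A *m J *m g^T.
  by rewrite ginv_def !mulmxA -[_ *m J *m J]mulmxA Imx_sqr mulmx1.
rewrite ginv_def !trmx_mul trmxK trmx_Imx !mulmxA Imx_sqr mul1mx.
by rewrite -[g *m J *m A^T]mulmxA hJ mulmxN mulNmx !mulmxA subrr.
Qed.

(** The highest weight vector: [p] is the stabilizer of its line. *)
Definition vnull : 'cV[R]_N := \col_i (m <= i)%:R.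

Lemma vnull_spa j : vnull (spa j) 0 = 0.
Proof. by rewrite mxE /= leqNgt ltn_ord. Qed.
Lemma vnull_prev : vnull iprev 0 = 1.
Proof. by rewrite mxE /= leq_addr. Qed.
Lemma vnull_last : vnull ilast 0 = 1.
Proof. by rewrite mxE /= leq_addr. Qed.

Lemma mul_vnull (A : 'M[R]_N) i : (A *m vnull) i 0 = A i iprev + A i ilast.
Proof.
rewrite mxE sum_index vnull_prev vnull_last !mulr1 big1 ?add0r // => j _.
by rewrite vnull_spa mulr0.
Qed.

Lemma form_vnull x : form x vnull = x iprev 0 - x ilast 0.
Proof.
rewrite /form sum_index vnull_prev vnull_last msign_prev msign_last big1.
  by rewrite add0r; ring.
by move=> j _; rewrite vnull_spa mulr0.
Qed.

Lemma vnull_null : form vnull vnull = 0.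
Proof. by rewrite form_vnull vnull_prev vnull_last subrr. Qed.

Lemma Xmx_spa_spa al i j : Xmx al (spa i) (spa j) = 0 :> R.
Proof. by rewrite block_mxEul !mxE. Qed.
Lemma Xmx_spa_prev al i : Xmx al (spa i) iprev = - al 0 i :> R.
Proof. by rewrite block_mxEur row_mxEl !mxE. Qed.
Lemma Xmx_spa_last al i : Xmx al (spa i) ilast = al 0 i :> R.
Proof. by rewrite block_mxEur row_mxEr !mxE. Qed.
Lemma Xmx_prev_spa al i : Xmx al iprev (spa i) = al 0 i :> R.
Proof. by rewrite block_mxEdl col_mxEu. Qed.
Lemma Xmx_last_spa al i : Xmx al ilast (spa i) = al 0 i :> R.
Proof. by rewrite block_mxEdl col_mxEd. Qed.
Lemma Xmx_dr al i j : Xmx al (rshift m i) (rshift m j) = 0 :> R.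
Proof. by rewrite block_mxEdr !mxE. Qed.
Definition XmxE := (Xmx_spa_spa, Xmx_spa_prev, Xmx_spa_last, Xmx_prev_spa,
  Xmx_last_spa, Xmx_dr).

Lemma H0_spa_spa i j : H0 R m (spa i) (spa j) = 0.
Proof. by rewrite block_mxEul !mxE. Qed.
Lemma H0_spa_r i j : H0 R m (spa i) (rshift m j) = 0.
Proof. by rewrite block_mxEur !mxE. Qed.
Lemma H0_r_spa i j : H0 R m (rshift m j) (spa i) = 0.
Proof. by rewrite block_mxEdl !mxE. Qed.
Lemma H0_prev_prev : H0 R m iprev iprev = 0.
Proof. by rewrite block_mxEdr block_mxEul !mxE. Qed.
Lemma H0_prev_last : H0 R m iprev ilast = 1.
Proof. by rewrite block_mxEdr block_mxEur !mxE. Qed.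
Lemma H0_last_prev : H0 R m ilast iprev = 1.
Proof. by rewrite block_mxEdr block_mxEdl !mxE. Qed.
Lemma H0_last_last : H0 R m ilast ilast = 0.
Proof. by rewrite block_mxEdr block_mxEdr !mxE. Qed.
Definition H0E := (H0_spa_spa, H0_prev_prev, H0_prev_last,
  H0_last_prev, H0_last_last, H0_spa_r, H0_r_spa).

Lemma ul_spa_spa (B : 'M[R]_m) i j : upper_left B (spa i) (spa j) = B i j.
Proof. by rewrite block_mxEul. Qed.
Lemma ul_spa_r (B : 'M[R]_m) i j : upper_left B (spa i) (rshift m j) = 0.
Proof. by rewrite block_mxEur !mxE. Qed.
Lemma ul_r_spa (B : 'M[R]_m) i j : upper_left B (rshift m j) (spa i) = 0.
Proof. by rewrite block_mxEdl !mxE. Qed.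
Lemma ul_r_r (B : 'M[R]_m) i j : upper_left B (rshift m i) (rshift m j) = 0.
Proof. by rewrite block_mxEdr !mxE. Qed.
Definition ulE := (ul_spa_spa, ul_spa_r, ul_r_spa, ul_r_r).

Lemma Xmx_vnull al : Xmx al *m vnull = 0.
Proof.
apply/colP => i; rewrite mul_vnull [RHS]mxE.
by case: (indexP i) => [[j ->]|->|->]; rewrite !XmxE ?addNr ?addr0.
Qed.

Lemma H0_vnull : H0 R m *m vnull = vnull.
Proof.
apply/colP => i; rewrite mul_vnull.
case: (indexP i) => [[j ->]|->|->];
  by rewrite !H0E ?vnull_spa ?vnull_prev ?vnull_last ?addr0 ?add0r.
Qed.

Lemma ul_vnull B : upper_left B *m vnull = 0.
Proof.
apply/colP => i; rewrite mul_vnull [RHS]mxE.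
by case: (indexP i) => [[j ->]|->|->]; rewrite !ulE addr0.
Qed.

(** The [n]-component of an element of [p]. *)
Definition nrow (A : 'M[R]_N) : 'rV[R]_m := \row_j A iprev (spa j).

Lemma so_decomp A : A \in so -> (forall j, (A *m vnull) (spa j) 0 = 0) ->
  A = upper_left (ulsubmx A) + A iprev ilast *: H0 R m + Xmx (nrow A).
Proof.
move=> /so_lorP Aso Av.
have Apl i : A (spa i) ilast = - A (spa i) iprev.
  by have := Av i; rewrite mul_vnull => h; lra.
have App : A iprev iprev = 0.
  by have := Aso iprev iprev; rewrite msign_prev => h; lra.
have All : A ilast ilast = 0.
  by have := Aso ilast ilast; rewrite msign_last => h; lra.
have Alp : A ilast iprev = A iprev ilast.
  by rewrite (Aso iprev ilast) msign_prev msign_last; ring.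
have Aps i : A iprev (spa i) = - A (spa i) iprev.
  by rewrite (Aso (spa i) iprev) msign_prev msign_spa; ring.
have Als i : A ilast (spa i) = - A (spa i) iprev.
  by rewrite (Aso (spa i) ilast) msign_last msign_spa Apl; ring.
apply/matrixP => i j; rewrite !addmxE scalemxE.
case: (indexP i) => [[i' ->]|->|->]; case: (indexP j) => [[j' ->]|->|->];
  rewrite !H0E ?XmxE ?ulE ?mxE ?App ?All ?Alp ?Aps ?Als ?Apl; ring.
Qed.

Lemma skewE B : (B \in Defs.skew R m) = (B + B^T == 0).
Proof.
rewrite memv_ker linfunE // => a C D; rewrite linearP /= scalerDr !addrA.
by congr (_ + _); rewrite -!addrA; congr (_ + _); rewrite addrC.
Qed.

Lemma so_skew A : A \in so -> ulsubmx A \in Defs.skew R m.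
Proof.
move=> /so_lorP Aso; rewrite skewE; apply/eqP/matrixP => i j; rewrite !mxE.
have := Aso (spa i) (spa j); rewrite !msign_spa /spa => h; lra.
Qed.

Lemma Xmx_lie_n al : Xmx al \in lie_n R m.
Proof. by rewrite -(linfunE (@Xmx_linear R m)) memv_img ?memvf. Qed.

Lemma Xmx_lie_p al : Xmx al \in lie_p R m.
Proof. by apply: (subvP (addvSr _ _)); exact: Xmx_lie_n. Qed.

Lemma H0_lie_p : H0 R m \in lie_p R m.
Proof.
apply: (subvP (addvSl _ _)); apply: (subvP (addvSr _ _)); exact: memv_line.
Qed.

Lemma ul_lie_p B : B \in Defs.skew R m -> upper_left B \in lie_p R m.
Proof.
move=> Bs; apply: (subvP (addvSl _ _)); apply: (subvP (addvSl _ _)).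
by rewrite -(linfunE (@upper_left_linear R m)) memv_img.
Qed.

Lemma lie_p_vnull A :
  A \in lie_p R m <-> A \in so /\ exists c, A *m vnull = c *: vnull.
Proof.
split=> [Ap|[Aso [c Av]]].
  split; first exact: (subvP (lie_p_sub R m)).
  case/memv_addP: Ap => _ /memv_addP[_ /memv_imgP[B _ ->] [_ /vlineP[c ->] ->]].
  case=> _ /memv_imgP[al _ ->] ->; exists c.
  rewrite (linfunE (@Xmx_linear R m)) (linfunE (@upper_left_linear R m)).
  by rewrite !mulmxDl -scalemxAl Xmx_vnull H0_vnull ul_vnull add0r addr0.
rewrite [A]so_decomp //; last by move=> j; rewrite Av mxE vnull_spa mulr0.
by rewrite !rpredD ?rpredZ ?Xmx_lie_p ?H0_lie_p ?ul_lie_p ?so_skew.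
Qed.

(** The restriction of a trace form to [n] only sees the spatial part of [A v]. *)
Lemma tr_mul_Xmx A al : A \in so ->
  \tr (A *m Xmx al) = 2 * \sum_j al 0 j * (A *m vnull) (spa j) 0.
Proof.
move=> /so_lorP Aso; rewrite /mxtrace sum_index !mulmxEs !sum_index.
have hp i : A iprev (spa i) = - A (spa i) iprev.
  by rewrite (Aso (spa i) iprev) msign_prev msign_spa; ring.
have hl i : A ilast (spa i) = A (spa i) ilast.
  by rewrite (Aso (spa i) ilast) msign_last msign_spa; ring.
rewrite !XmxE !mulr0 !addr0 -!big_split mulr_sumr /=.
apply: eq_bigr => i _; rewrite mul_vnull mulmxEs sum_index !XmxE big1.
  by rewrite hp hl; ring.
by move=> j _; rewrite XmxE mulr0.
Qed.

Lemma tr_mul_ul (A : 'M[R]_N) B : \tr (A *m upper_left B) = \tr (ulsubmx A *m B).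
Proof.
rewrite -[A in LHS]submxK mulmx_block !mulmx0 mxtrace_block.
by rewrite !addr0 mxtrace0 addr0.
Qed.

Lemma tr_mul_H0 A : A \in so -> \tr (A *m H0 R m) = 2 * A iprev ilast.
Proof.
move=> /so_lorP Aso; rewrite /mxtrace sum_index !mulmxEs !sum_index.
have Alp : A ilast iprev = A iprev ilast.
  by rewrite (Aso iprev ilast) msign_prev msign_last; ring.
rewrite !big1 => [|i _|i _|i _].
- by rewrite !H0E Alp; ring.
- by rewrite H0E mulr0.
- by rewrite H0E mulr0.
- rewrite mulmxEs sum_index big1 => [|j _]; first by rewrite !H0E; ring.
  by rewrite !H0E mulr0.
Qed.

(** The orthogonal of [p] for the trace form is [n]: pairing with [n] shows that
    [A] preserves the line of [v], so that it is in [p]; pairing with [H0] and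
    with its own [m]-component then removes everything but its [n]-component. *)
Lemma lie_p_perp A : A \in so ->
  (forall Y, Y \in lie_p R m -> \tr (A *m Y) = 0) -> A = Xmx (nrow A).
Proof.
move=> Aso Ap; rewrite [LHS]so_decomp // => [|j].
  have /eqP := Ap _ H0_lie_p; rewrite tr_mul_H0 // mulf_eq0 pnatr_eq0 /=.
  move=> /eqP ->; rewrite scale0r addr0.
  have /eqP := Ap _ (ul_lie_p (so_skew Aso)); rewrite tr_mul_ul.
  have Bs : ulsubmx A = - (ulsubmx A)^T.
    by have := so_skew Aso; rewrite skewE addr_eq0 => /eqP.
  rewrite {2}Bs mulmxN linearN oppr_eq0 /= => /eqP trB.
  suff -> : ulsubmx A = 0 by rewrite /upper_left block_mx0 add0r.
  apply/matrixP => i j; rewrite [RHS]mxE; apply/eqP; rewrite -sqrf_eq0.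
  move: trB; rewrite /mxtrace => /eqP; rewrite psumr_eq0 => [/allP /(_ i)|k _].
    rewrite mem_index_enum => /(_ isT); rewrite mxE psumr_eq0 => [/allP /(_ j)|k _].
      by rewrite mem_index_enum => /(_ isT); rewrite [_^T _ _]mxE -expr2.
    by rewrite [_^T _ _]mxE -expr2 sqr_ge0.
  by rewrite mxE sumr_ge0 // => l _; rewrite [_^T _ _]mxE -expr2 sqr_ge0.
have /eqP := Ap _ (Xmx_lie_p (delta_mx 0 j)); rewrite tr_mul_Xmx //.
rewrite mulf_eq0 pnatr_eq0 /= (bigD1 j) //= big1 => [|i ij].
  by rewrite mxE !eqxx mul1r addr0 => /eqP.
by rewrite mxE (negPf ij) mul0r.
Qed.

Definition iota_mx (A : 'M[R]_N) : dual (subvs_of so) :=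
  iota_form (vsproj so A).

Lemma iota_mxE A Y : A \in so -> iota_mx A Y = 2^-1 * \tr (A *m vsval Y).
Proof. by move=> Aso; rewrite iota_formE vsprojK. Qed.

Lemma moment_iota_mx A Y : A \in so ->
  moment (iota_mx A) Y = 2^-1 * \tr (A *m vsval Y).
Proof.
move=> Aso; rewrite momentE iota_mxE // vsprojK //.
by apply: (subvP (lie_p_sub R m)); exact: subvsP.
Qed.

Lemma moment_iota_mx_inj A A' : A \in so -> A' \in so ->
  moment (iota_mx A) = moment (iota_mx A') -> exists al, A' = A + Xmx al.
Proof.
move=> Aso A'so /lfunP h; exists (nrow (A' - A)).
rewrite -lie_p_perp ?rpredB // ?subrKC // => Y Yp.
have := h (vsproj _ Y); rewrite !moment_iota_mx // vsprojK // => hY.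
rewrite mulmxBl linearB /=; apply/eqP; rewrite subr_eq0; apply/eqP.
by apply: (mulfI (x := 2^-1)) => //; rewrite invr_eq0 pnatr_eq0.
Qed.

End LorentzAlgebra.

(** * The identity component of the Lorentz group *)

Section LorentzGroup.
Context {R : realType} {m : nat}.
Local Notation N := (m + (1 + 1))%N.
Local Notation J := (Imx R m).
Local Notation so := (so_lor R m).
Local Notation v := (@vnull R m).
Implicit Types (A g : 'M[R]_N) (B : 'M[R]_m) (al : 'rV[R]_m).

Lemma Omx_row g i : Omx g -> \sum_(j : 'I_N) msign j * g i j ^+ 2 = msign i.
Proof.
move=> /matrixP /(_ i i); rewrite !mxE eqxx mulr1n -/(msign i) => <-.
by apply: eq_bigr => j _; rewrite mulmx_Imx !mxE; ring.
Qed.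

Lemma Omx_ginv g : Omx g -> Omx (ginv g).
Proof.
move=> gO; rewrite /Omx /= ginv_def !trmx_mul trmxK trmx_Imx.
have -> : J *m g^T *m J *m J *m (J *m (g *m J)) = J *m (g^T *m J *m g) *m J.
  by rewrite !mulmxA -[_ *m J *m J]mulmxA Imx_sqr mulmx1.
by rewrite Omx_trmx // Imx_sqr mul1mx.
Qed.

Lemma Omx1 : Omx (1%:M : 'M[R]_N).
Proof. by rewrite /Omx /= mul1mx trmx1 mulmx1. Qed.

Lemma Omx_mul g h : Omx g -> Omx h -> Omx (g *m h).
Proof.
move=> gO hO; rewrite /Omx /= trmx_mul -!mulmxA.
rewrite [J *m _]mulmxA [h *m _]mulmxA [h *m _]mulmxA.
by rewrite (hO : h *m J *m h^T = J) mulmxA.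
Qed.

Lemma Omx_det g : Omx g -> \det g ^+ 2 = 1.
Proof.
move=> /mul_ginv /(congr1 determinant); rewrite ginv_def !det_mulmx det_tr det1.
have : \det J * \det J = 1 by rewrite -det_mulmx Imx_sqr det1.
move=> h1 h2; have -> : \det g ^+ 2 = (\det g * (\det J * \det g * \det J)) *
   (\det J * \det J) + \det g ^+ 2 * (1 - (\det J * \det J) ^+ 2) by ring.
by rewrite h2 h1; ring.
Qed.

Lemma Omx_last g : Omx g -> 1 <= g ilast ilast ^+ 2.
Proof.
move=> gO; have := Omx_row ilast gO; rewrite sum_index msign_prev msign_last.
have : 0 <= \sum_(j < m) msign (spa j) * g ilast (spa j) ^+ 2.
  by apply: sumr_ge0 => j _; rewrite msign_spa mul1r sqr_ge0.
by have := sqr_ge0 (g ilast iprev); lra.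
Qed.

Lemma SOe_Omx g : SOe g -> Omx g.
Proof. exact: connected_component_sub. Qed.

Lemma SOe1 : SOe (1%:M : 'M[R]_N).
Proof. by apply: connected_component_refl; exact: Omx1. Qed.

(** A continuous function without zeros on a connected set keeps its sign; this
    applies to the determinant, whose square is 1, and, in [SOe_last], to the
    last entry, whose square is at least 1. *)
Lemma SOe_det g : SOe g -> \det g = 1.
Proof.
move=> gS; have : 0 < \det g.
  apply: (connected_pos (A := @SOe R m) (x := 1%:M) (f := fun A : 'M[R]_N => \det A)) => //.
  - exact: det_continuous.
  - exact: component_connected.
  - move=> z /SOe_Omx /Omx_det h; apply/eqP => z0.
    by move: h; rewrite z0 expr0n /= => /eqP; rewrite eq_sym oner_eq0.
  - exact: SOe1.
  - by rewrite det1.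
move=> g0; have /eqP := Omx_det (SOe_Omx gS).
rewrite sqrf_eq1 => /orP[/eqP //|/eqP h].
by move: g0; rewrite h ltr0N1.
Qed.

Lemma SOe_last g : SOe g -> 0 < g ilast ilast.
Proof.
move=> gS.
apply: (connected_pos (A := @SOe R m) (x := 1%:M) (f := fun A : 'M[R]_N => A ilast ilast)) => //.
- exact: coord_continuous.
- exact: component_connected.
- move=> z /SOe_Omx /Omx_last h; apply/eqP => z0.
  by move: h; rewrite z0 expr0n /= ler10.
- exact: SOe1.
- by rewrite mxE eqxx.
Qed.

Lemma Omx_closed : closed (@Omx R m).
Proof.
have -> : @Omx R m = (fun g => g *m J *m g^T) @^-1` [set J] by [].
apply: closed_comp => [g _|].
  apply: mulmx_continuous; last by apply: trmx_continuous => x; exact: cvg_id.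
  apply: mulmx_continuous; first by move=> x; exact: cvg_id.
  exact: cst_continuous.
apply: accessible_closed_set1; apply: hausdorff_accessible.
exact: norm_hausdorff.
Qed.

Lemma SOe_closed : closed (@SOe R m).
Proof. by apply: component_closed; exact: Omx_closed. Qed.

(** The exponential of [Xmx al], whose cube is zero. *)
Definition expn al : 'M[R]_N := 1%:M + Xmx al + 2^-1 *: (Xmx al *m Xmx al).

Lemma expn_N0 al : N0 (expn al).
Proof. by exists al. Qed.

Lemma Xmx_so al : Xmx al \in so.
Proof. by apply: (subvP (lie_p_sub R m)); exact: Xmx_lie_p. Qed.

Definition spatial al : 'cV[R]_N := col_mx al^T 0.

Lemma spatial_spa al j : spatial al (spa j) 0 = al 0 j.
Proof. by rewrite col_mxEu mxE. Qed.

Lemma spatial_r al j : spatial al (rshift m j) 0 = 0.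
Proof. by rewrite col_mxEd mxE. Qed.

(** The expression [v a^* - a v^*] of an element of [n], from which both its
    nilpotency and the invariance of bordered determinants follow. *)
Lemma Xmx_rank2 al :
  Xmx al = v *m ((spatial al)^T *m J) - spatial al *m (v^T *m J).
Proof.
apply/matrixP => i j; rewrite [RHS]mxE [X in _ = _ + X]mxE !mulmxEs !big_ord1.
rewrite !mulmx_Imx ![_^T _ _]mxE.
case: (indexP i) => [[i' ->]|->|->]; case: (indexP j) => [[j' ->]|->|->];
  by rewrite XmxE ?spatial_spa ?spatial_r ?vnull_spa ?vnull_prev ?vnull_last
    ?msign_spa ?msign_prev ?msign_last; ring.
Qed.

Lemma Xmx_cube al : Xmx al *m Xmx al *m Xmx al = 0.
Proof.
rewrite {2}Xmx_rank2 mulmxBr !mulmxA Xmx_vnull !mul0mx sub0r !mulNmx -mulmxA.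
have -> : J *m Xmx al = - (Xmx al)^T *m J.
  have := Xmx_so al; rewrite so_lorE => /eqP h.
  have : J *m (Xmx al *m J + J *m (Xmx al)^T) *m J = 0 by rewrite h mulmx0 mul0mx.
  rewrite mulmxDr mulmxDl !mulmxA Imx_sqr mul1mx -mulmxA Imx_sqr mulmx1 => /eqP.
  by rewrite addr_eq0 mulNmx => /eqP.
rewrite !mulmxA -[_ *m v^T *m _]mulmxA mulmxN -trmx_mul Xmx_vnull trmx0.
by rewrite oppr0 mulmx0 mul0mx oppr0.
Qed.

Lemma XmxZ c al : Xmx (c *: al) = c *: Xmx al.
Proof.
have X0 : Xmx (0 : 'rV[R]_m) = 0.
  by have := @Xmx_linear R m (-1) 0 0; rewrite scaler0 addr0 scaleN1r addNr.
by have := @Xmx_linear R m c al 0; rewrite X0 !addr0.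
Qed.

Lemma XmxN al : Xmx (- al) = - Xmx al.
Proof. by rewrite -scaleN1r XmxZ scaleN1r. Qed.

Lemma expnN al : expn al *m expn (- al) = 1%:M.
Proof.
rewrite /expn XmxN mulmxN mulNmx opprK !mulmxDl !mulmxDr !mul1mx !mulmx1.
rewrite mulmxN -!scalemxAl -!scalemxAr mulmxN !mulmxA Xmx_cube mul0mx oppr0 !scaler0.
rewrite !addr0.
set X := Xmx al; set Y := X *m X.
by apply/matrixP => i j; rewrite !mxE; lra.
Qed.

Lemma expn_Omx al : Omx (expn al).
Proof.
rewrite /Omx /=.
have JX : J *m (Xmx al)^T = - Xmx al *m J.
  by have := Xmx_so al; rewrite so_lorE addrC addr_eq0 mulNmx => /eqP.
have -> : expn al *m J *m (expn al)^T = expn al *m expn (- al) *m J.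
  rewrite -!mulmxA; congr (_ *m _).
  have -> : (expn al)^T = 1%:M + (Xmx al)^T + 2^-1 *: ((Xmx al)^T *m (Xmx al)^T).
    by rewrite -trmx_mul -trmx1 -linearZ -!linearD.
  rewrite /expn !mulmxDr mulmx1 -scalemxAr mulmxA JX -mulmxA JX !XmxN.
  by rewrite !mulmxDl mul1mx -scalemxAl !mulmxA.
by rewrite expnN mul1mx.
Qed.

Lemma expn_SOe al : SOe (expn al).
Proof.
have -> : expn al = (fun u : R => expn (u *: al)) 1 by rewrite scale1r.
apply: (@connected_component_range R _ (@Omx R m) 1%:M
  (fun u => expn (u *: al))) => [||u]; last exact: expn_Omx; last first.
  by rewrite /expn !XmxZ !scale0r mul0mx scaler0 !addr0.
apply: mx_continuous => i j.
have -> : (fun u : R => expn (u *: al) i j) = (fun u =>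
   (1%:M : 'M[R]_N) i j + Xmx al i j * u + 2^-1 * (Xmx al *m Xmx al) i j * (u * u)).
  apply/funext => u; rewrite /expn !XmxZ -scalemxAl -scalemxAr !scalerA.
  by rewrite !addmxE !scalemxE; ring.
move=> u; apply: cvgD; [apply: cvgD; [exact: cvg_cst|]|];
  apply: cvgM; try exact: cvg_cst; try exact: cvg_id.
by apply: cvgM; exact: cvg_id.
Qed.

End LorentzGroup.

(** * The stabilizer of the null vector *)

Section Parabolic.
Context {R : realType} {m : nat}.
Local Notation N := (m + (1 + 1))%N.
Local Notation J := (Imx R m).
Local Notation so := (so_lor R m).
Local Notation v := (@vnull R m).
Implicit Types (A g : 'M[R]_N) (B : 'M[R]_m) (al : 'rV[R]_m).

Lemma col_mulmx p q r (A : 'M[R]_(p, q)) (B : 'M[R]_(q, r)) j :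
  col j (A *m B) = A *m col j B.
Proof. by rewrite !colE mulmxA. Qed.

Lemma iprev_ilast : (iprev == ilast :> 'I_N) = false.
Proof. by rewrite -val_eqE /= eqn_add2l. Qed.

Lemma spa_r i j : (spa i == rshift m j :> 'I_N) = false.
Proof. exact: eq_lrshift. Qed.

Lemma expn_ilast al i : expn al i ilast =
  (i == ilast)%:R + spatial al i 0 + 2^-1 * (\sum_j al 0 j ^+ 2) * v i 0.
Proof.
rewrite /expn !addmxE scalemxE [1%:M i ilast]mxE mulmxEs sum_index.
case: (indexP i) => [[i' ->]|->|->].
- rewrite !XmxE spatial_spa vnull_spa big1 => [|j _]; last by rewrite XmxE mul0r.
  by rewrite !mulr0 !addr0 mulr0 addr0.
- rewrite !XmxE spatial_r vnull_prev mulr1 !mulr0 !addr0; congr (_ + _ * _).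
  by apply: eq_bigr => j _; rewrite !XmxE expr2.
- rewrite !XmxE spatial_r vnull_last mulr1 !mulr0 !addr0; congr (_ + _ * _).
  by apply: eq_bigr => j _; rewrite !XmxE expr2.
Qed.

Lemma expn_vnull al : expn al *m v = v.
Proof.
by rewrite /expn !mulmxDl mul1mx -scalemxAl -mulmxA Xmx_vnull mulmx0 scaler0 !addr0.
Qed.

(** The elements of [A0]. *)
Definition boost (t : R) : 'M[R]_N := block_mx 1%:M 0 0
  (block_mx ((expR t + expR (- t)) / 2)%:M ((expR t - expR (- t)) / 2)%:M
            ((expR t - expR (- t)) / 2)%:M ((expR t + expR (- t)) / 2)%:M).

Lemma boost_vnull t : boost t *m v = expR t *: v.
Proof.
apply/colP => i; rewrite mul_vnull scalemxE.
case: (indexP i) => [[i' ->]|->|->].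
- by rewrite vnull_spa !block_mxEur !mxE; ring.
- rewrite vnull_prev /boost /iprev /ilast 2!block_mxEdr block_mxEul block_mxEur.
  by rewrite !mxE !mulr1n; field.
- rewrite vnull_last /boost /iprev /ilast 2!block_mxEdr block_mxEdl block_mxEdr.
  by rewrite !mxE !mulr1n; field.
Qed.

(** The vector [g^-1 e_last] is on the hyperboloid of unit timelike vectors and has
    the same product with [v] as [e_last]. Such vectors form one orbit of
    [N], freely parametrized by their spatial part; so [g] times a suitable element of
    [N] also fixes [e_last], hence the plane of [H0], and is in [M]. *)
Lemma fix_vnull g : SOe g -> g *m v = v ->
  exists x z, [/\ M0 x, N0 z & g = x *m z].
Proof.
move=> gS gv; have gO := SOe_Omx gS.
pose k := ginv g; have kO : Omx k by exact: Omx_ginv.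
have kv : k *m v = v by rewrite -{1}gv mulmxA ginv_mul // mul1mx.
pose al : 'rV[R]_m := \row_j k (spa j) ilast.
have [x xdef] : exists x, x = g *m expn al by exists (g *m expn al).
have xO : Omx x by rewrite xdef; apply: Omx_mul => //; exact: expn_Omx.
have ek : col ilast (expn al) = col ilast k.
  apply/colP => i; rewrite mxE [RHS]mxE expn_ilast.
  have h1 : \sum_j al 0 j ^+ 2 + k iprev ilast ^+ 2 - k ilast ilast ^+ 2 = -1.
    have : form (col ilast k) (col ilast k) = -1.
      have := @form_Omx R m k (delta_mx ilast 0) (delta_mx ilast 0) kO.
      rewrite -!colE => ->; rewrite /form (bigD1 ilast) //= big1 => [|j /negPf jl].
        by rewrite mxE !eqxx addr0 !mulr1 msign_last.
      by rewrite mxE jl mulr0.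
    rewrite /form sum_index msign_prev msign_last ![col _ _ _ _]mxE => <-.
    rewrite !mul1r mulN1r mulNr -!expr2; congr (_ + _ - _).
    by apply: eq_bigr => j _; rewrite msign_spa !mxE mul1r expr2.
  have h2 : k iprev ilast - k ilast ilast = -1.
    have := @form_Omx R m k (delta_mx ilast 0) v kO; rewrite kv !form_vnull -colE.
    by rewrite ![col _ _ _ _]mxE ![delta_mx _ _ _ _]mxE !eqxx iprev_ilast => ->; rewrite sub0r.
  set s := \sum_j _ in h1 *.
  case: (indexP i) => [[j ->]|->|->].
  - by rewrite spa_r vnull_spa spatial_spa mxE mulr0 addr0 add0r.
  - rewrite vnull_prev spatial_r iprev_ilast mulr1 addr0 add0r.
    have : (k iprev ilast - k ilast ilast) * (k iprev ilast + k ilast ilast) = -1 - s.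
      by rewrite -h1; ring.
    by rewrite h2 => h3; lra.
  - rewrite vnull_last spatial_r eqxx mulr1 addr0 mulr1n.
    have : (k iprev ilast - k ilast ilast) * (k iprev ilast + k ilast ilast) = -1 - s.
      by rewrite -h1; ring.
    by rewrite h2 => h3; lra.
have ev := expn_vnull al.
have xv : x *m v = v by rewrite xdef -mulmxA ev gv.
have xl i : x i ilast = (i == ilast)%:R.
  transitivity ((g *m col ilast (expn al)) i 0).
    by rewrite xdef -col_mulmx [RHS]mxE.
  by rewrite ek -col_mulmx mul_ginv // !mxE.
have xp i : x i iprev = (i == iprev)%:R.
  have /colP /(_ i) := xv; rewrite mul_vnull xl => h.
  have -> : x i iprev = v i 0 - (i == ilast)%:R by rewrite -h; ring.
  case: (indexP i) => [[j ->]|->|->].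
  - by rewrite vnull_spa !spa_r subr0.
  - by rewrite vnull_prev eqxx iprev_ilast subr0.
  - by rewrite vnull_last eqxx eq_sym iprev_ilast subrr.
have yv : ginv x *m v = v by rewrite -{1}xv mulmxA ginv_mul // mul1mx.
have yl i : ginv x i ilast = (i == ilast)%:R.
  have : (ginv x *m col ilast x) i 0 = (i == ilast)%:R.
    by rewrite -col_mulmx ginv_mul // !mxE.
  have -> : col ilast x = delta_mx ilast 0.
    by apply/colP => j; rewrite !mxE xl andbT.
  by rewrite -colE mxE.
have xL i : x ilast i = (i == ilast)%:R.
  have := yl i; rewrite ginvE msign_last.
  case: eqP => [->|_]; first by rewrite msign_last => <-; ring.
  by move/eqP; rewrite !mulf_eq0 oppr_eq0 oner_eq0 (negPf (msign_neq0 i)) /= => /eqP.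
have xP i : x iprev i = (i == iprev)%:R.
  have /colP /(_ i) := yv; rewrite mul_vnull !ginvE msign_prev msign_last xL => h.
  have : x iprev i = msign i * (v i 0 + msign i * (i == ilast)%:R).
    rewrite -h -[LHS]mul1r -{1}(msign_sqr i); ring.
  move=> ->; case: (indexP i) => [[j ->]|->|->].
  - by rewrite vnull_spa msign_spa !spa_r mulr0 addr0 mulr0.
  - by rewrite vnull_prev msign_prev iprev_ilast eqxx mulr0 addr0 !mulr1.
  - by rewrite vnull_last msign_last eqxx [ilast == _]eq_sym iprev_ilast mulr1n mulr0n; ring.
have xE : x = block_mx (ulsubmx x) 0 0 1%:M.
  apply/matrixP => i j; case: (split_ordP i) => i' ->; case: (split_ordP j) => j' ->.
  - by rewrite block_mxEul !mxE.
  - rewrite block_mxEur mxE; case: (split_ordP j') => j'' ->; rewrite !ord1.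
      by rewrite xp (spa_r i').
    by rewrite xl (spa_r i').
  - rewrite block_mxEdl mxE; case: (split_ordP i') => j'' ->; rewrite !ord1.
      by rewrite xP (spa_r j').
    by rewrite xL (spa_r j').
  - rewrite block_mxEdr mxE; case: (split_ordP j') => j'' ->; rewrite !ord1.
      by rewrite xp -!val_eqE /= eqn_add2l.
    by rewrite xl -!val_eqE /= eqn_add2l.
exists x, (expn (- al)); split; last by rewrite xdef -mulmxA expnN mulmx1.
- have [B BE] : exists B, B = ulsubmx x by exists (ulsubmx x).
  rewrite -BE in xE; exists B; last by rewrite -xE.
  split.
    have := xO; rewrite /Omx /= ImxE xE tr_block_mx !mulmx_block.
    rewrite !(mul0mx, mulmx0, mulmx1, mul1mx, addr0, add0r, trmx0, trmx1).
    by move=> /eq_block_mx[].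
  have : \det x = 1 by rewrite xdef det_mulmx !SOe_det ?mulr1 //; exact: expn_SOe.
  by rewrite xE det_ublock det1 mulr1.
- exact: expn_N0.
Qed.

Lemma parabolic_mx_vnull x y z : M0 x -> A0 y -> N0 z ->
  exists2 c, c != 0 & x *m y *m z *m v = c *: v.
Proof.
move=> [B _ <-] [t _ <-] [al _ <-]; exists (expR t); first by rewrite gt_eqF ?expR_gt0.
rewrite -/(expn al) -!mulmxA expn_vnull -/(boost t) boost_vnull -scalemxAr.
congr (_ *: _); apply/colP => i; rewrite mul_vnull.
case: (indexP i) => [[i' ->]|->|->].
- by rewrite vnull_spa !block_mxEur !mxE addr0.
- by rewrite vnull_prev !block_mxEdr !mxE -!val_eqE /= !(mulr0n, mulr1n); ring.
- by rewrite vnull_last !block_mxEdr !mxE -!val_eqE /= !(mulr0n, mulr1n); ring.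
Qed.

Lemma boost0 : boost 0 = 1%:M.
Proof.
have e1 : (expR 0 + expR (- 0)) / 2 = 1 :> R by rewrite oppr0 expR0; field.
have e2 : (expR 0 - expR (- 0)) / 2 = 0 :> R by rewrite oppr0 subrr mul0r.
by rewrite /boost e1 e2 raddf0 -!scalar_mx_block.
Qed.

End Parabolic.

(** * Partial fractions and plane rotations *)

Section PartialFractions.
Context {R : realType}.

(** After multiplication by the product of the distinct factors [x + c], the sum
    becomes a polynomial with infinitely many roots; evaluating it at
    [- mu i0] isolates the residue. The values of [mu] may repeat: the two
    coordinates of a plane of [t] share the same one. *)
Lemma partial_fractions (I : finType) (d mu : I -> R) :
  (forall i, 0 <= mu i) ->
  (forall x, 0 < x -> \sum_i d i / (x + mu i) = 0) ->
  forall i0, \sum_(i | mu i == mu i0) d i = 0.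
Proof.
move=> mu0 h i0.
pose S := undup [seq mu i | i <- enum I].
have muS i : mu i \in S by rewrite mem_undup map_f ?mem_enum.
pose P : {poly R} := \sum_i d i *: \prod_(c <- S | c != mu i) ('X + c%:P).
have Px x : P.[x] = \sum_i d i * \prod_(c <- S | c != mu i) (x + c).
  rewrite horner_sum; apply: eq_bigr => i _; rewrite hornerZ horner_prod.
  by congr (_ * _); apply: eq_bigr => c _; rewrite hornerD hornerX hornerC.
have P0 : P = 0.
  apply: (@roots_geq_poly_eq0 _ P [seq k.+1%:R | k <- iota 0 (size P)]).
  - apply/allP => _ /mapP[k _ ->]; rewrite /root Px; apply/eqP.
    have x0 : 0 < k.+1%:R :> R by rewrite ltr0n.
    transitivity ((\prod_(c <- S) (k.+1%:R + c)) * \sum_i d i / (k.+1%:R + mu i)).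
      rewrite mulr_sumr; apply: eq_bigr => i _.
      rewrite [X in _ = X * _](bigD1_seq (mu i)) ?undup_uniq //=.
      by field; rewrite gt_eqF // ltr_wpDr.
    by rewrite h // mulr0.
  - by rewrite map_inj_uniq ?iota_uniq // => a b /eqP; rewrite eqr_nat eqSS => /eqP.
  - by rewrite size_map size_iota.
have := Px (- mu i0); rewrite P0 horner0 (bigID (fun i => mu i == mu i0)) /=.
rewrite [X in _ + X]big1 ?addr0 => [|i ii0]; last first.
  apply/eqP; rewrite mulf_eq0 prodf_seq_eq0; apply/orP; right; apply/hasP.
  by exists (mu i0) => //; rewrite addNr eqxx eq_sym ii0.
rewrite (eq_bigr (fun i => d i * \prod_(c <- S | c != mu i0) (- mu i0 + c))); last first.
  by move=> i /eqP ->.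
rewrite -mulr_suml => /esym/eqP; rewrite mulf_eq0 => /orP[/eqP //|].
rewrite prodf_seq_eq0 => /hasP[c _ /andP[cmu]].
by rewrite addrC subr_eq0 (negPf cmu).
Qed.

Lemma rotation_exists (a b c d : R) : a ^+ 2 + b ^+ 2 = c ^+ 2 + d ^+ 2 ->
  exists phi, cos phi * a + sin phi * b = c /\ cos phi * b - sin phi * a = d.
Proof.
move=> h; have [ab0|ab0] := eqVneq (a ^+ 2 + b ^+ 2) 0.
  have : c ^+ 2 + d ^+ 2 == 0 by rewrite -h ab0.
  move: ab0 => /eqP; rewrite !paddr_eq0 ?sqr_ge0 // !sqrf_eq0.
  move=> /andP[/eqP a0 /eqP b0] /andP[/eqP c0 /eqP d0]; rewrite a0 b0 c0 d0.
  by exists 0; rewrite !mulr0 addr0 subr0.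
pose C := (a * c + b * d) / (a ^+ 2 + b ^+ 2).
pose S := (b * c - a * d) / (a ^+ 2 + b ^+ 2).
have CS : C ^+ 2 + S ^+ 2 = 1.
  have -> : C ^+ 2 + S ^+ 2 = (c ^+ 2 + d ^+ 2) / (a ^+ 2 + b ^+ 2).
    by rewrite /C /S; field.
  by rewrite -h divff.
have C1 : -1 <= C <= 1.
  by rewrite -ler_norml -[leRHS]normr1 -ler_sqr ?nnegrE // -normrX -normrX
     ger0_norm ?sqr_ge0 // expr1n normr1 -CS lerDl sqr_ge0.
have sC : sin (acos C) = `|S|.
  by rewrite sin_acos // -sqrtr_sqr; congr Num.sqrt; rewrite -CS; ring.
have [phi [cphi sphi]] : exists phi, cos phi = C /\ sin phi = S.
  have cC : cos (acos C) = C by rewrite acosK // in_itv.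
  have [S0|S0] := leP 0 S.
    by exists (acos C); rewrite sC ger0_norm.
  by exists (- acos C); rewrite cosN sinN sC ltr0_norm // opprK.
exists phi; rewrite cphi sphi /C /S; split; first by field.
by field.
Qed.

Lemma mx_eq_mulcV p q (A B : 'M[R]_(p, q)) :
  (forall x : 'cV[R]_q, A *m x = B *m x) -> A = B.
Proof.
by move=> h; apply/matrixP => i j; have /colP /(_ i) := h (delta_mx j 0);
  rewrite -!colE !mxE.
Qed.

End PartialFractions.

(** * Regular elliptic elements and their resolvents *)

Section Torus.
Context {R : realType} {m : nat}.
Local Notation N := (m + (1 + 1))%N.
Local Notation J := (Imx R m).
Local Notation v := (@vnull R m).
Context (s : 'I_N -> R) (sigma : 'I_N -> 'I_N).
Implicit Types (g : 'M[R]_N) (w x y : 'cV[R]_N).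

(** Bookkeeping for a block diagonal matrix of plane rotations: [sigma] exchanges
    the two coordinates of each plane and fixes the timelike index, and [s] is the
    nonzero entry of each row. The last two clauses say that the matrix is
    regular. *)
Definition paired := [/\ involutive sigma, (forall i, s (sigma i) = - s i),
  (forall i, (s i == 0) = (i == ilast)) &
  (forall i j, s j ^+ 2 = s i ^+ 2 -> j = i \/ j = sigma i)].

Definition tor : 'M[R]_N := \matrix_(i, j) (s i *+ (j == sigma i)).

Hypothesis sP : paired.

Lemma sigmaK : involutive sigma. Proof. by case: sP. Qed.
Lemma s_sigma i : s (sigma i) = - s i. Proof. by case: sP. Qed.
Lemma s_eq0 i : (s i == 0) = (i == ilast). Proof. by case: sP. Qed.
Lemma s_sqr_inj i j : s j ^+ 2 = s i ^+ 2 -> j = i \/ j = sigma i.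
Proof. by case: sP => _ _ _; apply. Qed.

Lemma sigma_last : sigma ilast = ilast.
Proof. by apply/eqP; rewrite -s_eq0 s_sigma oppr_eq0 s_eq0. Qed.

Lemma msign_ilastE (i : 'I_N) : msign i = if i == ilast then -1 else 1 :> R.
Proof.
case: (indexP i) => [[j ->]|->|->]; first by rewrite msign_spa spa_r.
  by rewrite msign_prev iprev_ilast.
by rewrite msign_last eqxx.
Qed.

Lemma msign_sigma i : msign (sigma i) = msign i :> R.
Proof. by rewrite !msign_ilastE -!s_eq0 s_sigma oppr_eq0. Qed.

Lemma eq_sigma i j : (i == sigma j) = (j == sigma i).
Proof. by rewrite -(inj_eq (inv_inj sigmaK)) sigmaK eq_sym. Qed.

Lemma sum_delta (F : 'I_N -> R) k : \sum_i F i *+ (i == k) = F k.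
Proof.
rewrite (bigD1 k) //= eqxx mulr1n big1 ?addr0 // => i /negPf ->.
by rewrite mulr0n.
Qed.

Lemma tor_mul x i : (tor *m x) i 0 = s i * x (sigma i) 0.
Proof.
rewrite mxE -[RHS](sum_delta (fun j => s i * x j 0)).
by apply: eq_bigr => j _; rewrite mxE mulrnAl.
Qed.

Lemma form_tor x y : form (tor *m x) (tor *m y) = \sum_i s i ^+ 2 * (x i 0 * y i 0).
Proof.
rewrite /form (reindex_inj (inv_inj sigmaK)).
apply: eq_bigr => i _; rewrite !tor_mul sigmaK s_sigma.
have [->|il] := eqVneq i ilast.
  have /eqP -> : s ilast == 0 by rewrite s_eq0.
  by rewrite !(mulr0, mul0r, oppr0, expr0n) ?mul0r.
rewrite msign_sigma (msign_ilastE i) (negPf il); ring.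
Qed.

Lemma tor_so : tor \in so_lor R m.
Proof.
apply/so_lorP => i j; rewrite !mxE eq_sigma; case: eqP => [->|_].
  by rewrite s_sigma msign_sigma msign_sqr mul1r.
by rewrite !mulr0n mulr0 oppr0.
Qed.

(** The inverse of [l - t], equal to [(l + t) / (l ^ 2 - t ^ 2)] where [t ^ 2] is
    diagonal. *)
Definition resolvent (l : R) : 'M[R]_N := \matrix_(i, j)
  ((l *+ (j == i) + s i *+ (j == sigma i)) / (l ^+ 2 + s i ^+ 2)).

Lemma resolvent_mul l x i :
  (resolvent l *m x) i 0 = (l * x i 0 + s i * x (sigma i) 0) / (l ^+ 2 + s i ^+ 2).
Proof.
rewrite mxE.
have -> : l * x i 0 + s i * x (sigma i) 0 =
   \sum_j ((l * x j 0) *+ (j == i) + (s i * x j 0) *+ (j == sigma i)).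
  by rewrite big_split /= !sum_delta.
rewrite mulr_suml; apply: eq_bigr => j _.
by rewrite mxE -[l * _ *+ _]mulrnAl -[s i * _ *+ _]mulrnAl; ring.
Qed.

Lemma resolventP l : l != 0 -> (l%:M - tor) *m resolvent l = 1%:M.
Proof.
move=> l0; have d0 i : l ^+ 2 + s i ^+ 2 != 0.
  by rewrite gt_eqF // ltr_wpDr ?sqr_ge0 // exprn_even_gt0 //= l0 orbT.
apply: mx_eq_mulcV => x; rewrite mul1mx -mulmxA mulmxBl mul_scalar_mx.
apply/colP => i; rewrite 2!mxE [X in _ + X]mxE tor_mul !resolvent_mul s_sigma sigmaK.
have := d0 i; have -> : (- s i) ^+ 2 = s i ^+ 2 by ring.
by move=> h; field.
Qed.

(** The remaining terms, odd in [t], cancel in pairs under [sigma]. *)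
Lemma form_resolvent l w : form w (resolvent l *m w) =
  l * \sum_i msign i * w i 0 ^+ 2 / (l ^+ 2 + s i ^+ 2).
Proof.
rewrite /form; under eq_bigr do rewrite resolvent_mul.
pose Q i := msign i * s i * w i 0 * w (sigma i) 0 / (l ^+ 2 + s i ^+ 2).
have Q0 : \sum_i Q i = 0.
  have : \sum_i Q i = - \sum_i Q i.
    rewrite {1}(reindex_inj (inv_inj sigmaK)) -sumrN; apply: eq_bigr => i _.
    by rewrite /Q msign_sigma s_sigma sigmaK sqrrN; ring.
  by move=> h; lra.
rewrite mulr_sumr -[RHS]addr0 -[X in _ = _ + X]Q0 -big_split /=.
apply: eq_bigr => i _.
by rewrite /Q; ring.
Qed.

Definition bordered (A : 'M[R]_N) (l : R) x : 'M[R]_(N + 1) :=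
  block_mx (l%:M - A) x (x^T *m J) 0.

(** The Schur complement of the block [l - A]. *)
Lemma det_bordered A l x y : (l%:M - A) *m y = x ->
  \det (bordered A l x) = - (\det (l%:M - A) * form x y).
Proof.
move=> Ay; have -> : bordered A l x =
    block_mx (l%:M - A) 0 (x^T *m J) 1%:M *m block_mx 1%:M y 0 (- (x^T *m J *m y)).
  rewrite mulmx_block !mulmx1 !mulmx0 !mul0mx !mul1mx !addr0 Ay.
  by rewrite subrr.
rewrite det_mulmx det_lblock det_ublock !det1 mul1r mulr1 formE.
by rewrite [- (_ *m y)]mx11_scalar det_scalar1 mxE mulrN.
Qed.

(** The block matrices on both sides are the row and column operations that
    absorb the two terms of [v a^* - a v^*] using the border. *)
Lemma bordered_Xmx A l al :
  \det (bordered (A + Xmx al) l v) = \det (bordered A l v).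
Proof.
pose a := spatial al.
have -> : bordered (A + Xmx al) l v =
    block_mx 1%:M a 0 1%:M *m bordered A l v *m block_mx 1%:M 0 (- (a^T *m J)) 1%:M.
  rewrite /bordered !mulmx_block !mulmx1 !mulmx0 !mul0mx !mul1mx !addr0 !add0r.
  rewrite mul0mx addr0; congr block_mx.
  by rewrite Xmx_rank2 mulmxN -/a !opprD !addrA opprK; rewrite addrAC -!addrA.
by rewrite !det_mulmx det_ublock det_lblock !det1 !mulr1 mul1r.
Qed.

Lemma det_conj A g l : Omx g -> \det (l%:M - g *m A *m ginv g) = \det (l%:M - A).
Proof.
move=> gO; have -> : l%:M - g *m A *m ginv g = g *m (l%:M - A) *m ginv g.
  by rewrite mulmxBr mulmxBl scalar_mxC -[l%:M *m g *m _]mulmxA mul_ginv // mulmx1.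
have := congr1 determinant (mul_ginv gO); rewrite det_mulmx det1 => e.
by rewrite 2!det_mulmx mulrAC e mul1r.
Qed.

Lemma det_bordered_tor g l : Omx g -> l != 0 ->
  \det (bordered (g *m tor *m ginv g) l v) =
  - (\det (l%:M - tor) *
     (l * \sum_i msign i * (ginv g *m v) i 0 ^+ 2 / (l ^+ 2 + s i ^+ 2))).
Proof.
move=> gO l0; set w := ginv g *m v.
have gw : g *m w = v by rewrite mulmxA mul_ginv // mul1mx.
rewrite (@det_bordered _ _ _ (g *m (resolvent l *m w))).
  by rewrite det_conj // -{1}gw form_Omx // form_resolvent.
have -> : l%:M - g *m tor *m ginv g = g *m (l%:M - tor) *m ginv g.
  by rewrite mulmxBr mulmxBl scalar_mxC -[l%:M *m g *m _]mulmxA mul_ginv // mulmx1.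
rewrite -!mulmxA [ginv g *m _]mulmxA ginv_mul // mul1mx.
by rewrite [(_ - _) *m _]mulmxA resolventP // mul1mx gw.
Qed.

(** Two points of the orbit with the same moment image have null vectors with the
    same radii: their bordered determinants agree for all [l], and the radii are
    the residues of the resolvent coefficient as a function of [l ^ 2]. *)
Lemma radii_determined g g' al : Omx g -> Omx g' ->
  g' *m tor *m ginv g' = g *m tor *m ginv g + Xmx al ->
  forall i, (ginv g *m v) i 0 ^+ 2 + (ginv g *m v) (sigma i) 0 ^+ 2 =
            (ginv g' *m v) i 0 ^+ 2 + (ginv g' *m v) (sigma i) 0 ^+ 2.
Proof.
move=> gO g'O eA i0; set w := ginv g *m v; set w' := ginv g' *m v.
pose d i := msign i * (w i 0 ^+ 2 - w' i 0 ^+ 2).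
(* Only [x = l ^ 2 > 0] is reached by a real nonzero [l]. *)
have dP (x : R) : 0 < x -> \sum_i d i / (x + s i ^+ 2) = 0.
  move=> x0; pose l := Num.sqrt x.
  have l0 : l != 0 by rewrite gt_eqF // sqrtr_gt0.
  have := bordered_Xmx (g *m tor *m ginv g) l al.
  rewrite -eA !det_bordered_tor // -/w -/w' => /eqP.
  rewrite eqr_opp -subr_eq0 -mulrBr -mulrBr mulf_eq0 => /orP[|].
    move=> /eqP det0; have := congr1 determinant (resolventP l0).
    by rewrite det_mulmx det0 mul0r det1 => /eqP; rewrite eq_sym oner_eq0.
  rewrite mulf_eq0 (negPf l0) /= -sumrB sqr_sqrtr ?ltW // => /eqP h.
  apply: oppr_inj; rewrite oppr0 -[RHS]h -sumrN; apply: eq_bigr => i _.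
  by rewrite /d; ring.
have := partial_fractions (fun i => sqr_ge0 (s i)) dP i0.
have -> : \sum_(i | s i ^+ 2 == s i0 ^+ 2) d i = \sum_(i in [set i0; sigma i0]%SET) d i.
  apply: eq_bigl => i; rewrite !inE; apply/eqP/orP => [/s_sqr_inj[] ->|[] /eqP ->].
  - by left.
  - by right.
  - by [].
  - by rewrite s_sigma sqrrN.
have m0 := msign_neq0 (R := R) i0.
have [e|ne] := eqVneq (sigma i0) i0.
  rewrite e finset.setUid big_set1 /d => /eqP; rewrite mulf_eq0 (negPf m0) /= subr_eq0.
  by move=> /eqP ->.
rewrite big_setU1 ?inE 1?eq_sym //= big_set1 /d msign_sigma -mulrDr => /eqP.
rewrite mulf_eq0 (negPf m0) /= => /eqP h; lra.
Qed.

Definition rot (phi : 'I_N -> R) : 'M[R]_N := \matrix_(i, j)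
  (cos (phi i) *+ (j == i) + sin (phi i) *+ (j == sigma i)).

Lemma rot_mul phi x i :
  (rot phi *m x) i 0 = cos (phi i) * x i 0 + sin (phi i) * x (sigma i) 0.
Proof.
rewrite mxE -(sum_delta (fun j => cos (phi i) * x j 0)).
rewrite -(sum_delta (fun j => sin (phi i) * x j 0)) -big_split /=.
by apply: eq_bigr => j _; rewrite mxE mulrDl !mulrnAl.
Qed.

Lemma rot_Omx phi : (forall i, phi (sigma i) = - phi i) -> Omx (rot phi).
Proof.
move=> phiN.
have rr : rot phi *m rot (fun i => - phi i) = 1%:M.
  apply: mx_eq_mulcV => x; rewrite mul1mx -mulmxA; apply/colP => i.
  rewrite !rot_mul phiN opprK sigmaK cosN sinN.
  have := cos2Dsin2 (phi i) => h.
  transitivity ((cos (phi i) ^+ 2 + sin (phi i) ^+ 2) * x i 0); first by ring.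
  by rewrite h mul1r.
have rT : (rot phi)^T = rot (fun i => - phi i).
  apply/matrixP => i j; rewrite !mxE cosN sinN [i == j]eq_sym eq_sigma.
  congr (_ + _); case: eqP => [->|_] //.
  by rewrite phiN sinN.
have rJ : rot phi *m J = J *m rot phi.
  apply/matrixP => i j; rewrite mulmx_Imx Imx_mulmx mxE.
  rewrite mulrDl mulrDr; congr (_ + _); case: eqP => [->|_];
    by rewrite ?msign_sigma ?mulr0n ?mulr0 ?mul0r 1?mulrC.
by rewrite /Omx /= rJ rT -mulmxA rr mulmx1.
Qed.

Lemma rot_SOe phi : (forall i, phi (sigma i) = - phi i) -> SOe (rot phi).
Proof.
move=> phiN; pose f (u : R) := rot (fun i => u * phi i).
have -> : rot phi = f 1.
  by congr rot; apply/funext => i; rewrite mul1r.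
apply: (@connected_component_range R _ (@Omx R m) 1%:M f) => [||u].
- apply: mx_continuous => i j.
  have -> : (fun u : R => f u i j) = (fun u : R => cos (u * phi i) * (j == i)%:R +
      sin (u * phi i) * (j == sigma i)%:R).
    by apply/funext => u; rewrite mxE !mulr_natr.
  have lin : continuous (fun u : R => u * phi i).
    by apply: mulr_fun_continuous; [move=> u; exact: cvg_id | exact: cst_continuous].
  have cc : continuous (fun u : R => cos (u * phi i)).
    move=> u; apply: (@continuous_comp _ _ _ (fun u : R => u * phi i) cos).
      exact: lin.
    exact: continuous_cos.
  have sc : continuous (fun u : R => sin (u * phi i)).
    move=> u; apply: (@continuous_comp _ _ _ (fun u : R => u * phi i) sin).
      exact: lin.
    exact: continuous_sin.
  move=> u; apply: cvgD; apply: cvgM; try exact: cvg_cst; [exact: cc|exact: sc].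
- apply: mx_eq_mulcV => x; apply/colP => i.
  by rewrite rot_mul !mul0r cos0 sin0 mul1mx mul1r mul0r addr0.
- by apply: rot_Omx => i; rewrite phiN mulrN.
Qed.

Lemma rot_tor phi : (forall i, phi (sigma i) = - phi i) ->
  rot phi *m tor = tor *m rot phi.
Proof.
move=> phiN; apply: mx_eq_mulcV => x; rewrite -!mulmxA; apply/colP => i.
by rewrite rot_mul !tor_mul rot_mul sigmaK phiN cosN sinN s_sigma; ring.
Qed.

(** The angle is chosen once for each plane, at the index of positive weight, and
    transferred to the other index with the opposite sign. *)
Lemma rot_transitive w w' : w ilast 0 = w' ilast 0 ->
  (forall i, w i 0 ^+ 2 + w (sigma i) 0 ^+ 2 = w' i 0 ^+ 2 + w' (sigma i) 0 ^+ 2) ->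
  exists tau, [/\ SOe tau, tau *m tor = tor *m tau & tau *m w = w'].
Proof.
move=> wl we.
have /choice[ang angP] : forall i, exists phi,
    cos phi * w i 0 + sin phi * w (sigma i) 0 = w' i 0 /\
    cos phi * w (sigma i) 0 - sin phi * w i 0 = w' (sigma i) 0.
  by move=> i; exact: rotation_exists.
pose phi i := if 0 < s i then ang i else if s i < 0 then - ang (sigma i) else 0.
have phiN i : phi (sigma i) = - phi i.
  rewrite /phi s_sigma oppr_gt0 oppr_lt0 sigmaK.
  by case: ltgtP; rewrite ?opprK ?oppr0.
exists (rot phi); split; [exact: rot_SOe | exact: rot_tor |].
apply/colP => i; rewrite rot_mul /phi; case: ltgtP => [si|si|si].
- by have [] := angP i.
- by rewrite cosN sinN; have [_] := angP (sigma i); rewrite sigmaK => <-; ring.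
- have /eqP -> : i == ilast by rewrite -s_eq0 -si.
  by rewrite cos0 sin0 mul1r mul0r addr0.
Qed.

End Torus.

(** * Orbits of the spin group and fibres of the moment map *)

Section Spin.
Context {R : realType} {m : nat}.
Local Notation N := (m + (1 + 1))%N.
Local Notation J := (Imx R m).
Local Notation v := (@vnull R m).
Local Notation so := (so_lor R m).
Context {G : topGroupType} {rho : G -> 'M[R]_N}.
Hypothesis hG : is_spin rho.
Implicit Types (A : 'M[R]_N) (g p : G).

Lemma rho_SOe g : SOe (rho g).
Proof. by case: hG => _ _ [_ + _]; apply. Qed.

Lemma rho_surj x : SOe x -> exists g, rho g = x.
Proof.
case: hG => _ _ [_ _ hc] xS; have [W [_ Wx [V0 [_ [_ _ _ [hV _ _] _]]]]] := hc x xS.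
have : (rho @` V0) x by rewrite hV.
by case=> g _ <-; exists g.
Qed.

Lemma rhoM g p : rho (g * p)%g = rho g *m rho p.
Proof. by case: hG. Qed.

Lemma rho_Omx g : Omx (rho g). Proof. exact: SOe_Omx (rho_SOe g). Qed.

Lemma rho1 : rho 1%g = 1%:M.
Proof.
have h : rho 1%g *m rho 1%g = rho 1%g by rewrite -rhoM mulg1.
by rewrite -[LHS]mul1mx -(ginv_mul (rho_Omx 1%g)) -mulmxA h.
Qed.

Lemma rhoV g : rho (g^-1)%g = ginv (rho g).
Proof.
rewrite -[LHS]mulmx1 -(mul_ginv (rho_Omx g)) mulmxA -rhoM mulVg rho1.
by rewrite mul1mx.
Qed.

Definition conj_rho g A := rho g *m A *m rho (g^-1)%g.

Lemma conj_rho_so g A : A \in so -> conj_rho g A \in so.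
Proof. by move=> Aso; rewrite /conj_rho rhoV conj_so //; exact: rho_Omx. Qed.

Lemma conj_rhoM p g A : conj_rho p (conj_rho g A) = conj_rho (p * g)%g A.
Proof. by rewrite /conj_rho invgM !rhoM !mulmxA. Qed.

Lemma coAd_iota_mx g A : A \in so -> coAd rho g (iota_mx A) = iota_mx (conj_rho g A).
Proof.
move=> Aso; apply/lfunP => Y; rewrite coAdE !iota_mxE ?conj_rho_so // /Ad invgK.
rewrite vsprojK; last first.
  by have := conj_rho_so (g^-1)%g (subvsP Y); rewrite /conj_rho invgK.
by rewrite /conj_rho mulmxA mxtrace_mulC !mulmxA.
Qed.

(** [p] is the stabilizer of the line of [v], so it is stable under the elements
    having [v] as an eigenvector. *)
Lemma lie_p_Ad p c Y : c != 0 -> rho p *m v = c *: v -> Y \in lie_p R m ->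
  rho (p^-1)%g *m Y *m rho p \in lie_p R m.
Proof.
move=> c0 pv /lie_p_vnull[Yso [d Yv]]; apply/lie_p_vnull; split.
  by have := conj_rho_so (p^-1)%g Yso; rewrite /conj_rho invgK.
exists d; rewrite -mulmxA pv -scalemxAr -mulmxA Yv -!scalemxAr.
have -> : rho (p^-1)%g *m v = c^-1 *: v.
  by rewrite -[v in LHS](scalerK c0) -pv -scalemxAr mulmxA -rhoM mulVg rho1 mul1mx.
by rewrite !scalerA; congr (_ *: _); rewrite mulrAC divff // mul1r.
Qed.

Lemma moment_coAd p c A : c != 0 -> rho p *m v = c *: v -> A \in so ->
  moment (coAd rho p (iota_mx A)) = coAd rho p (moment (iota_mx A)).
Proof.
move=> c0 pv Aso; apply/lfunP => Y.
rewrite coAd_iota_mx // coAdE !moment_iota_mx ?conj_rho_so // /Ad invgK.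
rewrite vsprojK; last by apply: lie_p_Ad pv _ => //; exact: subvsP.
by apply/esym; rewrite /conj_rho mulmxA mxtrace_mulC !mulmxA.
Qed.

Lemma parabolic_vnull p : parabolic rho p ->
  exists2 c, c != 0 & rho p *m v = c *: v.
Proof. by move=> [x [y [z [xM yA zN ->]]]]; exact: parabolic_mx_vnull. Qed.

Lemma fix_vnull_parabolic p : rho p *m v = v -> parabolic rho p.
Proof.
move=> /(fix_vnull (rho_SOe p))[x [z [xM zN e]]].
exists x, 1%:M, z; split; rewrite ?mulmx1 //.
by rewrite -boost0; exists 0.
Qed.

(** Elements of the identity component preserve the time orientation. *)
Lemma vnull_pos (g : 'M[R]_N) : SOe g -> 0 < (ginv g *m v) ilast 0.
Proof.
move=> gS; rewrite mul_vnull.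
have k0 : 0 < ginv g ilast ilast by rewrite ginvE msign_sqr mul1r SOe_last.
have := Omx_row ilast (Omx_ginv (SOe_Omx gS)).
rewrite sum_index msign_prev msign_last.
have : 0 <= \sum_(j < m) msign (spa j) * ginv g ilast (spa j) ^+ 2.
  by apply: sumr_ge0 => j _; rewrite msign_spa mul1r sqr_ge0.
set a := ginv g ilast iprev; set b := ginv g ilast ilast in k0 *.
by move=> h0 h1; nra.
Qed.

Context {s : 'I_N -> R} {sigma : 'I_N -> 'I_N}.
Hypothesis sP : paired s sigma.
Local Notation t := (tor s sigma).
Local Notation f := (iota_mx t).

Lemma orbitP h : coad_orbit rho f h <-> exists g, h = iota_mx (conj_rho g t).
Proof.
have tso := tor_so sP.
by split=> [[g _ <-]|[g ->]]; exists g => //; rewrite coAd_iota_mx.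
Qed.

(** The element [g' tau g^-1], with [tau] commuting with [t] and carrying
    [g^-1 v] to [g'^-1 v]. *)
Lemma fiber_transitive g g' :
  moment (iota_mx (conj_rho g t)) = moment (iota_mx (conj_rho g' t)) ->
  exists2 p, rho p *m v = v & conj_rho p (conj_rho g t) = conj_rho g' t.
Proof.
have tso := tor_so sP.
move=> /(moment_iota_mx_inj (conj_rho_so g tso) (conj_rho_so g' tso))[al eA0].
have eA : rho g' *m t *m ginv (rho g') = rho g *m t *m ginv (rho g) + Xmx al.
  by move: eA0; rewrite /conj_rho !rhoV.
have gO := rho_Omx g; have g'O := rho_Omx g'.
have we := radii_determined sP gO g'O eA.
have wl := we ilast; rewrite (sigma_last sP) in wl.
have wl' : (ginv (rho g) *m v) ilast 0 = (ginv (rho g') *m v) ilast 0.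
  have h1 := vnull_pos (rho_SOe g); have h2 := vnull_pos (rho_SOe g').
  by apply: (pexpIrn (n := 2)); rewrite ?nnegrE ?ltW //; lra.
have [tau [tauS tauC tauw]] := rot_transitive sP wl' we.
have [k kE] := rho_surj tauS.
exists (g' * k * g^-1)%g.
  by rewrite !rhoM kE rhoV -!mulmxA tauw mulmxA mul_ginv // mul1mx.
rewrite conj_rhoM -mulgA mulVg mulg1 -conj_rhoM; congr conj_rho.
by rewrite /conj_rho kE tauC -mulmxA -kE -rhoM mulgV rho1 mulmx1.
Qed.

(** The unique orbit is the whole fibre. *)
Lemma reduced_space_singleton g :
  exists orb, reduced_space rho f (moment (coAd rho g f)) = [set orb].
Proof.
have tso := tor_so sP.
set h := moment _; exists (preimage_q rho f [set h]).
have xorb x : preimage_q rho f [set h] x ->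
    [set coAd rho p x | p in stab_P rho h] = preimage_q rho f [set h].
  move=> [/orbitP[g1 ->] xh]; apply/seteqP; split=> [_ [p [pP ph] <-]|y].
    have [c c0 pv] := parabolic_vnull pP.
    split.
      by apply/orbitP; exists (p * g1)%g; rewrite coAd_iota_mx ?conj_rho_so // conj_rhoM.
    by rewrite /preimage /= (moment_coAd c0 pv) ?conj_rho_so // xh.
  move=> [/orbitP[g2 ->] yh].
  have [p pv pE] := fiber_transitive (etrans xh (esym yh)).
  exists p; last by rewrite coAd_iota_mx ?conj_rho_so // pE.
  split; first exact: fix_vnull_parabolic.
  have pv1 : rho p *m v = 1 *: v by rewrite scale1r.
  by rewrite -[h in LHS]xh -(moment_coAd (oner_neq0 _) pv1) ?conj_rho_so // coAd_iota_mx
    ?conj_rho_so // pE.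
apply/seteqP; split=> [_ [x xh <-]|_ ->]; first exact: xorb.
exists (coAd rho g f); last by apply: xorb; split; [exists g | ].
by split; [exists g |].
Qed.

(** The squared length of the [nbar]-component, up to a constant. It equals [<A v, A v>] since the
    two other coordinates of [A v], which is orthogonal to [v], cancel. *)
Lemma beta_sqr (g : 'M[R]_N) : Omx g ->
  \sum_(j < m) ((g *m t *m ginv g *m v) (spa j) 0) ^+ 2 =
  \sum_i s i ^+ 2 * (ginv g *m v) i 0 ^+ 2.
Proof.
move=> gO; have Aso := conj_so gO (tor_so sP).
set A := g *m t *m ginv g in Aso *; set w := ginv g *m v.
have gw : A *m v = g *m (t *m w) by rewrite /A /w !mulmxA.
have e1 : form (A *m v) (A *m v) = \sum_i s i ^+ 2 * w i 0 ^+ 2.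
  by rewrite gw form_Omx // (form_tor sP); under eq_bigr do rewrite -expr2.
have e2 : (A *m v) iprev 0 = (A *m v) ilast 0.
  apply/eqP; rewrite -subr_eq0 -form_vnull; apply/eqP.
  by have := form_so v v Aso; rewrite [form v _]formC => h; lra.
rewrite -e1 /form sum_index msign_prev msign_last e2 mul1r mulN1r mulNr addrK.
by apply: eq_bigr => j _; rewrite msign_spa mul1r expr2.
Qed.

(** For the null vector [w], the squared radii sum to [w ilast ^ 2]. *)
Lemma radius_bounds (g : 'M[R]_N) (a b : R) : Omx g ->
  (forall i, i != ilast -> a <= s i ^+ 2) ->
  (forall i, s i ^+ 2 <= b) ->
  a * (ginv g *m v) ilast 0 ^+ 2 <= \sum_i s i ^+ 2 * (ginv g *m v) i 0 ^+ 2 <=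
  b * (ginv g *m v) ilast 0 ^+ 2.
Proof.
move=> gO ha hb; set w := ginv g *m v.
have w0 : \sum_(i | i != ilast) w i 0 ^+ 2 = w ilast 0 ^+ 2.
  have : form w w = 0 by rewrite form_Omx ?vnull_null //; exact: Omx_ginv.
  rewrite /form (bigD1 ilast) //= msign_last.
  rewrite (eq_bigr (fun i => w i 0 ^+ 2)) => [h|i il]; first by lra.
  by rewrite msign_ilastE (negPf il) mul1r expr2.
have -> : \sum_i s i ^+ 2 * w i 0 ^+ 2 = \sum_(i | i != ilast) s i ^+ 2 * w i 0 ^+ 2.
  rewrite (bigD1 ilast) //=; have /eqP -> : s ilast == 0 by rewrite (s_eq0 sP).
  by rewrite expr0n /= mul0r add0r.
rewrite -w0 !mulr_sumr; apply/andP; split; apply: ler_sum => i il;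
  by rewrite ler_wpM2r ?sqr_ge0 ?ha ?hb.
Qed.

End Spin.

Arguments conj_rho {R m G} rho g A.

(** * Boosts *)

Section Boost.
Context {R : realType} {m : nat}.
Local Notation N := (m + (1 + 1))%N.
Local Notation J := (Imx R m).
Implicit Types (x : 'cV[R]_N) (u : R).

Definition ch u : R := (expR u + expR (- u)) / 2.
Definition sh u : R := (expR u - expR (- u)) / 2.

Lemma boost_mul u x : [/\ forall j, (boost u *m x) (spa j) 0 = x (spa j) 0,
  (boost u *m x) iprev 0 = ch u * x iprev 0 + sh u * x ilast 0 &
  (boost u *m x) ilast 0 = sh u * x iprev 0 + ch u * x ilast 0].
Proof.
rewrite /boost -/(ch u) -/(sh u) -[x]vsubmxK -[dsubmx x]vsubmxK.
rewrite !mul_block_col !mul0mx !mul1mx addr0 add0r !mul_scalar_mx.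
split=> [j||]; rewrite /iprev /ilast ?col_mxEu ?col_mxEd //.
  by rewrite !col_mxEu addmxE !scalemxE.
by rewrite !col_mxEu addmxE !scalemxE.
Qed.

Lemma expR_inv u : expR (- u) * expR u = 1 :> R.
Proof. by rewrite expRN mulVf // gt_eqF ?expR_gt0. Qed.

Lemma ch_sh u : ch u ^+ 2 - sh u ^+ 2 = 1.
Proof. by rewrite -(expR_inv u) /ch /sh; field. Qed.

Lemma tr_boost u : (boost u : 'M[R]_N)^T = boost u.
Proof. by rewrite /boost !tr_block_mx !trmx0 !tr_scalar_mx. Qed.

Lemma boost_Omx u : Omx (boost u : 'M[R]_N).
Proof.
rewrite /Omx /= tr_boost; apply: mx_eq_mulcV => x; rewrite -!mulmxA.
have [ys yp yl] := boost_mul u (J *m (boost u *m x)).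
have [xs xp xl] := boost_mul u x; have h := ch_sh u.
apply/colP => i; rewrite [RHS]Imx_mulmx.
case: (indexP i) => [[j ->]|->|->].
- by rewrite ys Imx_mulmx xs.
- rewrite yp !Imx_mulmx xp xl msign_prev msign_last.
  transitivity ((ch u ^+ 2 - sh u ^+ 2) * x iprev 0); first by ring.
  by rewrite h.
- rewrite yl !Imx_mulmx xp xl msign_prev msign_last.
  transitivity (- (ch u ^+ 2 - sh u ^+ 2) * x ilast 0); first by ring.
  by rewrite h.
Qed.

Lemma boost_SOe u : SOe (boost u : 'M[R]_N).
Proof.
apply: (@connected_component_range R _ (@Omx R m) 1%:M boost) => [||w].
- have ec : continuous (fun u : R => expR u) by exact: continuous_expR.
  have enc : continuous (fun u : R => expR (- u)).
    move=> u0; apply: (@continuous_comp _ _ _ (fun u : R => - u) expR).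
      exact: opp_continuous.
    exact: continuous_expR.
  have cc : continuous ch.
    by apply: mulr_fun_continuous; [move=> u0; apply: cvgD; [exact: ec|exact: enc]
      | exact: cst_continuous].
  have sc : continuous sh.
    by apply: mulr_fun_continuous; [move=> u0; apply: cvgB; [exact: ec|exact: enc]
      | exact: cst_continuous].
  apply: mx_continuous => i j.
  have e (w : R) : boost w i j = (boost w *m (delta_mx j 0 : 'cV_N)) i 0.
    by rewrite -colE [RHS]mxE.
  have -> : (fun w : R => boost w i j) =
            (fun w : R => (boost w *m (delta_mx j 0 : 'cV_N)) i 0).
    by apply/funext => w; rewrite e.
  set y : 'cV_N := delta_mx j 0.
  case: (indexP i) => [[i' ->]|->|->].
  + have -> : (fun w : R => (boost w *m y) (spa i') 0) = (fun=> y (spa i') 0).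
      by apply/funext => w; have [] := boost_mul w y.
    exact: cst_continuous.
  + have -> : (fun w : R => (boost w *m y) iprev 0) =
       (fun w => ch w * y iprev 0 + sh w * y ilast 0).
      by apply/funext => w; have [] := boost_mul w y.
    by move=> w; apply: cvgD; apply: cvgM; try exact: cvg_cst; [exact: cc|exact: sc].
  + have -> : (fun w : R => (boost w *m y) ilast 0) =
       (fun w => sh w * y iprev 0 + ch w * y ilast 0).
      by apply/funext => w; have [] := boost_mul w y.
    by move=> w; apply: cvgD; apply: cvgM; try exact: cvg_cst; [exact: sc|exact: cc].
- exact: boost0.
- exact: boost_Omx.
Qed.

Lemma Xmx_mul al x : [/\
  forall j, (Xmx al *m x) (spa j) 0 = al 0 j * (x ilast 0 - x iprev 0),
  (Xmx al *m x) iprev 0 = \sum_j al 0 j * x (spa j) 0 &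
  (Xmx al *m x) ilast 0 = \sum_j al 0 j * x (spa j) 0].
Proof.
split=> [j||]; rewrite mulmxEs sum_index !XmxE.
- by rewrite big1 => [|i _]; [ring | rewrite XmxE mul0r].
- by rewrite !mul0r !addr0; apply: eq_bigr => j _; rewrite XmxE.
- by rewrite !mul0r !addr0; apply: eq_bigr => j _; rewrite XmxE.
Qed.

Lemma boost_Xmx u (al : 'rV[R]_m) :
  boost u *m Xmx al = expR u *: (Xmx al *m boost u).
Proof.
apply: mx_eq_mulcV => x; rewrite -scalemxAl -!mulmxA; apply/colP => i.
have [bs bp bl] := boost_mul u x.
have [ys yp yl] := boost_mul u (Xmx al *m x).
have [zs zp zl] := Xmx_mul al (boost u *m x).
have [xs xp xl] := Xmx_mul al x.
have chsh : ch u + sh u = expR u by rewrite /ch /sh; field.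
have e1 : expR u * (ch u - sh u) = 1 by rewrite -(expR_inv u) /ch /sh; field.
have eS : \sum_j al 0 j * (boost u *m x) (spa j) 0 = \sum_j al 0 j * x (spa j) 0.
  by apply: eq_bigr => j _; rewrite bs.
rewrite scalemxE; case: (indexP i) => [[j ->]|->|->].
- rewrite ys xs zs bp bl.
  transitivity ((expR u * (ch u - sh u)) * (al 0 j * (x ilast 0 - x iprev 0))).
    by rewrite e1 mul1r.
  by ring.
- by rewrite yp xp xl zp eS -mulrDl chsh.
- by rewrite yl xp xl zl eS -mulrDl addrC chsh.
Qed.

Lemma boost_trXmx u (al : 'rV[R]_m) :
  boost u *m (Xmx al)^T = expR (- u) *: ((Xmx al)^T *m boost u).
Proof.
have := congr1 trmx (boost_Xmx u al).
rewrite linearZ /= !trmx_mul tr_boost => ->.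
by rewrite scalerA expR_inv scale1r.
Qed.

Lemma boost_ul u (B : 'M[R]_m) : boost u *m upper_left B = upper_left B *m boost u.
Proof.
by rewrite /boost /upper_left !mulmx_block !(mulmx0, mul0mx, mulmx1, mul1mx, addr0).
Qed.

End Boost.

(** * Bounds on the preimage of a compact set *)

Section TraceForm.
Context {R : realType} {N : nat}.
Implicit Types (V : {vspace 'M[R]_N}) (A : 'M[R]_N).

(** Defined for all matrices, so that it is a continuous function of [A]. *)
Definition trform V A : dual (subvs_of V) :=
  linfun (fun Y : subvs_of V => 2^-1 * \tr (A *m vsval Y) : R^o).

Lemma trformE V A Y : trform V A Y = 2^-1 * \tr (A *m vsval Y).
Proof.
apply: (@linfunE R (subvs_of V) R^o) => a Y1 Y2.
rewrite [vsval (_ + _)]linearP mulmxDr -scalemxAr mxtraceD mxtraceZ mulrDr.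
congr (_ + _); exact: mulrCA.
Qed.

Lemma trform_continuous V (T : topologicalType) (F : T -> 'M[R]_N) :
  continuous F -> continuous (fun x => trform V (F x)).
Proof.
move=> Fc; apply: dual_continuous => Y.
have -> : (fun x => trform V (F x) Y : R) =
          (fun x => 2^-1 * \tr (F x *m vsval Y)).
  by apply/funext => x; rewrite trformE.
apply: mulr_fun_continuous; first exact: cst_continuous.
apply: mxtrace_continuous; apply: mulmx_continuous => //; exact: cst_continuous.
Qed.

End TraceForm.

Lemma compact_fun_bounded (R : realType) (T : topologicalType) (K : set T)
    (phi : T -> R) :
  compact K -> {in K, continuous phi} -> exists C, forall h, K h -> `|phi h| <= C.
Proof.
move=> Kc phic; have : compact (phi @` K).
  by apply: continuous_compact => //; exact: continuous_in_subspaceT.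
move=> /compact_bounded[M [_ hM]]; exists (M + 1) => h Kh.
by apply: hM; [rewrite ltrDl | exists h].
Qed.

Section Proper.
Context {R : realType} {m : nat}.
Local Notation N := (m + (1 + 1))%N.
Local Notation J := (Imx R m).
Local Notation v := (@vnull R m).
Local Notation so := (so_lor R m).
Local Notation lp := (lie_p R m).

Lemma iota_mx_trform A : A \in so -> iota_mx A = trform so A.
Proof. by move=> Aso; apply/lfunP => Y; rewrite iota_mxE // trformE. Qed.

Lemma moment_trform A : A \in so -> moment (iota_mx A) = trform lp A.
Proof. by move=> Aso; apply/lfunP => Y; rewrite moment_iota_mx // trformE. Qed.

Context {s : 'I_N -> R} {sigma : 'I_N -> 'I_N}.
Hypothesis sP : paired s sigma.
Local Notation t := (tor s sigma).
Implicit Types g k : 'M[R]_N.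

Lemma s_bounds : exists a b : R, [/\ 0 < a, 0 < b,
  (forall i, i != ilast -> a <= s i ^+ 2) & (forall i, s i ^+ 2 <= b)].
Proof.
exists (1 + \sum_i (s i ^+ 2)^-1)^-1, (1 + \sum_i s i ^+ 2).
have p1 : 0 < 1 + \sum_i (s i ^+ 2)^-1 :> R.
  by rewrite ltr_wpDr // sumr_ge0 // => i _; rewrite invr_ge0 sqr_ge0.
split=> [|||i].
- by rewrite invr_gt0.
- by rewrite ltr_wpDr // sumr_ge0 // => i _; rewrite sqr_ge0.
- move=> i; rewrite -(s_eq0 sP) => si0.
  have sp : 0 < s i ^+ 2 by rewrite exprn_even_gt0 //= si0.
  rewrite -[leRHS]invrK lef_pV2 ?posrE ?invr_gt0 //.
  rewrite (bigD1 i) //= addrCA lerDl addr_ge0 // sumr_ge0 // => j _.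
  by rewrite invr_ge0 sqr_ge0.
- rewrite (bigD1 i) //= addrCA lerDl addr_ge0 // sumr_ge0 // => j _.
  by rewrite sqr_ge0.
Qed.

(** The rows and columns of [k] have Lorentz square 1 or -1. *)
Lemma Omx_entry_bound k i j : Omx k -> `|k i j| <= 1 + `|k ilast ilast|.
Proof.
move=> kO; have k'O := Omx_ginv kO.
have sqr_le (F : 'I_N -> R) e : \sum_l msign l * F l ^+ 2 = e ->
    forall j, F j ^+ 2 <= Num.max 0 e + F ilast ^+ 2.
  move=> h {}j; have [->|jl] := eqVneq j ilast.
    by rewrite lerDr le_max lexx.
  move: h; rewrite (bigD1 ilast) //= (bigD1 j) //= msign_last msign_ilastE (negPf jl).
  set S := \sum_(_ | _) _; have S0 : 0 <= S.
    by apply: sumr_ge0 => l /andP[ll _]; rewrite msign_ilastE (negPf ll) mul1r sqr_ge0.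
  have : e <= Num.max 0 e by rewrite le_max lexx orbT.
  by lra.
have h1 := sqr_le _ _ (Omx_row i kO) j.
have h2 : k i ilast ^+ 2 <= k ilast ilast ^+ 2.
  have := sqr_le _ _ (Omx_row ilast k'O) i.
  rewrite !ginvE msign_last !exprMn -!expr2 !sqrrN ?expr1n.
  have -> : msign i ^+ 2 = 1 :> R by rewrite expr2 msign_sqr.
  by rewrite max_l ?lerN10 // !(expr1n, mul1r, sqrrN, add0r, mulr1).
have h3 : Num.max 0 (msign i) <= 1 :> R.
  by rewrite ge_max ler01 /msign; case: ifP => _; rewrite ?lexx // (le_trans (lerN10 _) ler01).
have h4 : `|k i j| ^+ 2 <= (1 + `|k ilast ilast|) ^+ 2.
  rewrite real_normK ?num_real // sqrrD expr1n real_normK ?num_real //.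
  by have := normr_ge0 (k ilast ilast); rewrite mul1r; lra.
by rewrite -ler_sqr ?nnegrE ?addr_ge0.
Qed.

(** Bounds on the last row of [k = g^-1]. Let [w = k v]. For a spatial basis vector
    [e_j], subtracting from [k e_j] the multiple of [w] with the same last coordinate
    leaves a Euclidean unit vector [x1]. As [t w] has positive square [b2], the
    equality [<X v, X e_j> = <t w, t x1> + (c j / w_) b2] bounds that last
    coordinate [c j]. The sum [w_] of the two other entries of the row is
    confined by [b2], and the Lorentz square of the row determines them. *)
Lemma boundedness (C eps : R) : 0 < eps -> exists D : R, forall g,
  SOe g -> let A := g *m t *m ginv g in
  eps <= \sum_(j < m) ((A *m v) (spa j) 0) ^+ 2 ->
  \sum_(j < m) ((A *m v) (spa j) 0) ^+ 2 <= C ->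
  (forall j, `|form (A *m v) (A *m delta_mx (spa j) 0)| <= C) ->
  forall i j, `|g i j| <= D.
Proof.
move=> eps0; have [a [b [a0 b0 sa sb]]] := s_bounds.
(* [W] bounds [w_], [E] bounds the [c j] and [K] bounds the last entry of [g^-1]. *)
pose W := 1 + C / a.
pose E := (C + b * W * N%:R) * W / eps.
pose K := (W + (1 + m%:R * E ^+ 2) * (W * b / eps)) / 2.
exists (1 + K) => g gS A; have gO := SOe_Omx gS.
rewrite /A (beta_sqr sP gO); set w := ginv g *m v.
have /andP[] := radius_bounds sP gO sa sb; rewrite -/w.
set b2 := \sum_i s i ^+ 2 * w i 0 ^+ 2; move=> lb ub eb2 b2C GC.
have w0 : 0 < w ilast 0 := vnull_pos gS.
pose w_ : R := w ilast 0; rewrite -/w_ in lb ub w0.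
have b20 : 0 < b2 := lt_le_trans eps0 eb2.
have C0 : 0 < C := lt_le_trans b20 b2C.
have wW : w_ <= W.
  have h : w_ ^+ 2 <= C / a by rewrite ler_pdivlMr // mulrC; lra.
  by rewrite /W; have := sqr_ge0 (w_ - 1); nra.
have W0 : 0 < W by exact: lt_le_trans w0 wW.
have wi : w_^-1 <= W * b / eps.
  rewrite ler_pdivlMr // -(ler_pM2l w0) mulrA divff ?gt_eqF // mul1r.
  by nra.
have wn : form w w = 0 by rewrite form_Omx ?vnull_null //; exact: Omx_ginv.
have gw : g *m w = v by rewrite mulmxA mul_ginv // mul1mx.
have wiw i : `|w i 0| <= w_.
  have [->|il] := eqVneq i ilast; first by rewrite ger0_norm // ltW.
  rewrite -ler_sqr ?nnegrE ?normr_ge0 ?(ltW w0) // real_normK ?num_real //.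
  have := wn; rewrite /form (bigD1 ilast) //= (bigD1 i) //= msign_last (msign_ilastE i) (negPf il).
  set S := \sum_(_ | _) _; have S0 : 0 <= S.
    apply: sumr_ge0 => l /andP[ll _]; rewrite msign_ilastE (negPf ll) mul1r -expr2.
    exact: sqr_ge0.
  by rewrite -/w_; lra.
pose c j := ginv g ilast (spa j).
have cE j : `|c j| <= E.
  pose y := ginv g *m (delta_mx (spa j) 0 : 'cV_N).
  have yl : y ilast 0 = c j by rewrite /y -colE mxE.
  pose x1 := y + (- (c j / w_)) *: w.
  have x1l : x1 ilast 0 = 0.
    by rewrite /x1 addmxE scalemxE yl -/w_ mulNr divfK ?subrr // gt_eqF.
  have yw : form y w = 0.
    rewrite form_Omx; last exact: Omx_ginv.
    by rewrite form_vnull !mxE ![_ == spa j]eq_sym !spa_r subrr.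
  have yy : form y y = 1.
    rewrite form_Omx; last exact: Omx_ginv.
    rewrite /form (bigD1 (spa j)) //= big1 => [|i /negPf ij].
      by rewrite mxE !eqxx msign_spa addr0 !mulr1.
    by rewrite mxE ij !mulr0.
  have x11 : form x1 x1 = 1.
    by rewrite /x1 !formDl !formDr !formZl !formZr yy wn yw formC yw; ring.
  have x1i i : `|x1 i 0| <= 1.
    have [->|il] := eqVneq i ilast; first by rewrite x1l normr0 ler01.
    rewrite -ler_sqr ?nnegrE ?normr_ge0 // real_normK ?num_real // expr1n.
    have := x11; rewrite /form (bigD1 ilast) //= (bigD1 i) //= x1l msign_last.
    rewrite (msign_ilastE i) (negPf il).
    set S := \sum_(_ | _) _; have S0 : 0 <= S.
      apply: sumr_ge0 => l /andP[ll _]; rewrite msign_ilastE (negPf ll) mul1r -expr2.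
      exact: sqr_ge0.
    by lra.
  have tx1 : `|form (t *m w) (t *m x1)| <= b * w_ * N%:R.
    have -> : b * w_ * N%:R = \sum_(i < N) b * w_.
      by rewrite sumr_const card_ord mulr_natr.
    rewrite (form_tor sP); apply: le_trans (ler_norm_sum _ _ _) _; apply: ler_sum => i _.
    rewrite normrM (ger0_norm (sqr_ge0 _)) [`|w i 0 * _|]normrM.
    apply: ler_pM; rewrite ?sqr_ge0 ?mulr_ge0 ?normr_ge0 ?sb //.
    by rewrite -[w_]mulr1; apply: ler_pM; rewrite ?normr_ge0.
  have Gj := GC j.
  have GE : form (A *m v) (A *m delta_mx (spa j) 0) =
            form (t *m w) (t *m x1) + c j / w_ * b2.
    have -> : A *m v = g *m (t *m w) by rewrite /A /w !mulmxA.
    have -> : A *m (delta_mx (spa j) 0 : 'cV_N) = g *m (t *m y) by rewrite /A /y !mulmxA.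
    rewrite form_Omx //.
    have -> : y = x1 + (c j / w_) *: w by rewrite /x1 -addrA -scalerDl addNr scale0r addr0.
    rewrite mulmxDr -scalemxAr formDr formZr [form (t *m w) (t *m w)](form_tor sP).
    by congr (_ + _ * _); apply: eq_bigr => i _; rewrite expr2.
  have h1 : `|c j / w_ * b2| <= C + b * W * N%:R.
    have -> : c j / w_ * b2 = form (A *m v) (A *m delta_mx (spa j) 0)
                              - form (t *m w) (t *m x1) by rewrite GE; ring.
    apply: le_trans (ler_normB _ _) _; rewrite lerD //.
    by apply: le_trans tx1 _; rewrite ler_wpM2r // ler_wpM2l // ltW.
  have -> : c j = (c j / w_ * b2) * w_ / b2 by field; rewrite !gt_eqF.
  have w0' := ltW w0; have b20' := ltW b20.
  rewrite normrM normrM (ger0_norm w0') [`|b2^-1|]ger0_norm ?invr_ge0 // /E.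
  apply: ler_pM; rewrite ?mulr_ge0 ?normr_ge0 ?invr_ge0 //; last by rewrite lef_pV2 ?posrE.
  by apply: ler_pM; rewrite ?normr_ge0.
have kK : `|ginv g ilast ilast| <= K.
  have k0 : 0 < ginv g ilast ilast by rewrite ginvE msign_sqr mul1r SOe_last.
  rewrite (ger0_norm (ltW k0)).
  have := Omx_row ilast (Omx_ginv gO).
  rewrite sum_index msign_prev msign_last.
  have -> : \sum_(j < m) msign (spa j) * ginv g ilast (spa j) ^+ 2 = \sum_j c j ^+ 2.
    by apply: eq_bigr => j _; rewrite msign_spa mul1r.
  have wE : w_ = ginv g ilast iprev + ginv g ilast ilast by rewrite /w_ mul_vnull.
  have cS : \sum_j c j ^+ 2 <= m%:R * E ^+ 2.
    have -> : m%:R * E ^+ 2 = \sum_(i < m) E ^+ 2.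
      by rewrite sumr_const card_ord mulr_natl.
    apply: ler_sum => j _; rewrite -real_normK ?num_real //.
    by rewrite lerXn2r ?nnegrE ?normr_ge0 // (le_trans (normr_ge0 _) (cE j)).
  set p := ginv g ilast iprev in wE *; set q := ginv g ilast ilast in wE *.
  set S := \sum_j _ in cS * => h.
  have qE : q = (w_ + (1 + S) * w_^-1) / 2.
    have : (q - p) * w_ = 1 + S by rewrite wE; lra.
    move=> <-; rewrite mulfK ?gt_eqF // wE.
    by field.
  rewrite qE /K ler_pM2r ?invr_gt0 ?ltr0n // lerD //.
  have S0 : 0 <= S by apply: sumr_ge0 => j _; exact: sqr_ge0.
  by apply: ler_pM; rewrite ?invr_ge0 ?addr_ge0 ?(ltW w0) // lerD2l.
move=> i j.
have -> : `|g i j| = `|ginv g j i|.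
  rewrite ginvE normrM normrM.
  have n1 (l : 'I_N) : `|msign l| = 1 :> R.
    by rewrite /msign; case: ifP => _; rewrite ?normrN normr1.
  by rewrite !n1 !mul1r.
apply: le_trans (Omx_entry_bound _ _ (Omx_ginv gO)) _.
by rewrite lerD2l.
Qed.

End Proper.

(** * Properness of the moment map *)

Section Moment.
Context {R : realType} {m : nat}.
Local Notation N := (m + (1 + 1))%N.
Local Notation v := (@vnull R m).
Local Notation so := (so_lor R m).
Local Notation lp := (lie_p R m).
Implicit Types (A : 'M[R]_N) (h : dual (subvs_of lp)).

(** In terms of a point [X] of the orbit: the coordinates of the [nbar]-component
    up to a constant factor, the entries of the [m]-component up to sign, the [a]-component, and the numbers
    [<X v, X v>] and [<X v, X e_j>], as functions of the moment image. *)
Definition beta_coord j h : R := h (vsproj lp (Xmx (delta_mx 0 j))).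
Definition so_coord i j h : R := h (vsproj lp (upper_left (delta_mx i j - delta_mx j i))).
Definition a_coord h : R := h (vsproj lp (H0 R m)).
Definition beta_sq h : R := \sum_j beta_coord j h ^+ 2.
Definition beta_cross j h : R :=
  \sum_i beta_coord i h * so_coord j i h - a_coord h * beta_coord j h.

Lemma beta_coord_trform A j : A \in so -> beta_coord j (trform lp A) = (A *m v) (spa j) 0.
Proof.
move=> Aso; rewrite /beta_coord trformE vsprojK ?Xmx_lie_p // tr_mul_Xmx //.
rewrite (bigD1 j) //= big1 => [|i ij]; last by rewrite mxE (negPf ij) mul0r.
by rewrite mxE !eqxx addr0 mul1r; field.
Qed.

Lemma so_coord_trform A i j : A \in so -> so_coord i j (trform lp A) = - A (spa i) (spa j).
Proof.
move=> Aso; rewrite /so_coord trformE vsprojK; last first.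
  by apply: ul_lie_p; rewrite skewE linearB /= !trmx_delta addrA addrNK subrr.
rewrite tr_mul_ul mulmxBr linearB /=.
have e (B : 'M[R]_m) k l : \tr (B *m delta_mx k l) = B l k.
  rewrite /mxtrace (bigD1 l) //= big1 => [|i' il].
    rewrite mxE (bigD1 k) //= big1 => [|i' ik]; first by rewrite mxE !eqxx mulr1 !addr0.
    by rewrite mxE (negPf ik) mulr0.
  by rewrite mxE big1 // => k' _; rewrite mxE (negPf il) andbF mulr0.
rewrite !e !mxE.
have := so_lorP _ Aso (spa i) (spa j); rewrite !msign_spa /spa => ->.
by field.
Qed.

Lemma a_coord_trform A : A \in so -> a_coord (trform lp A) = A iprev ilast.
Proof.
move=> Aso; rewrite /a_coord trformE vsprojK ?H0_lie_p // tr_mul_H0 //.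
by field.
Qed.

Lemma beta_sq_trform A : A \in so ->
  beta_sq (trform lp A) = \sum_j ((A *m v) (spa j) 0) ^+ 2.
Proof. by move=> Aso; apply: eq_bigr => j _; rewrite beta_coord_trform. Qed.

Lemma beta_cross_trform A j : A \in so ->
  beta_cross j (trform lp A) = form (A *m v) (A *m delta_mx (spa j) 0).
Proof.
move=> Aso; have /so_lorP As := Aso.
rewrite /beta_cross beta_coord_trform // a_coord_trform // /form sum_index msign_prev msign_last.
rewrite !mul_vnull -!colE ![col _ _ _ _]mxE.
have -> : A iprev iprev = 0.
  by have := As iprev iprev; rewrite msign_prev => h; lra.
have -> : A ilast ilast = 0.
  by have := As ilast ilast; rewrite msign_last => h; lra.
rewrite (As iprev ilast) (As (spa j) iprev) (As (spa j) ilast).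
rewrite msign_prev msign_last msign_spa -addrA; congr (_ + _); last by ring.
apply: eq_bigr => i _; rewrite beta_coord_trform // so_coord_trform // mul_vnull msign_spa.
by rewrite [col _ _ _ _]mxE (As (spa i) (spa j)) !msign_spa; ring.
Qed.

Lemma beta_sq_continuous : continuous beta_sq.
Proof.
apply: sum_continuous => j _.
by apply: mulr_fun_continuous; exact: eval_continuous.
Qed.

Lemma beta_cross_continuous j : continuous (beta_cross j).
Proof.
apply: subr_fun_continuous; last by apply: mulr_fun_continuous; exact: eval_continuous.
apply: sum_continuous => i _.
by apply: mulr_fun_continuous; exact: eval_continuous.
Qed.

(** [n] is orthogonal to [p]. *)
Lemma trform_Xmx A al : trform lp (A + Xmx al) = trform lp A.
Proof.
apply/lfunP => Y; rewrite !trformE mulmxDl linearD /= mulrDr [X in _ + X](_ : _ = 0) ?addr0 //.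
have /lie_p_vnull[Yso [c Yv]] := subvsP Y.
rewrite mxtrace_mulC tr_mul_Xmx // big1 ?mulr0 // => j _.
by rewrite Yv scalemxE vnull_spa !mulr0.
Qed.

Context {G : topGroupType} {rho : G -> 'M[R]_N}.
Hypothesis hG : is_spin rho.
Context {s : 'I_N -> R} {sigma : 'I_N -> 'I_N}.
Hypothesis sP : paired s sigma.
Local Notation t := (tor s sigma).
Local Notation f := (iota_mx t).

Lemma beta_sq_gt0 g : 0 < beta_sq (trform lp (conj_rho rho g t)).
Proof.
rewrite beta_sq_trform ?conj_rho_so ?tor_so // /conj_rho rhoV //.
have [a [b [a0 b0 sa sb]]] := s_bounds sP.
have gO := rho_Omx hG g.
rewrite (beta_sqr sP gO).
have /andP[h _] := radius_bounds sP gO sa sb.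
apply: lt_le_trans h; rewrite mulr_gt0 // exprn_gt0 //.
exact: vnull_pos (rho_SOe hG g).
Qed.

Lemma image_depth_one : moment @` coad_orbit rho f `<=` [set h | depth_one h].
Proof.
move=> _ [_ /(orbitP hG sP)[g ->] <-] h0.
rewrite moment_trform ?conj_rho_so ?tor_so // in h0.
have := beta_sq_gt0 g; rewrite /beta_sq big1 ?ltxx // => j _.
by rewrite /beta_coord h0 ?expr0n // vsprojK ?Xmx_lie_p ?Xmx_lie_n.
Qed.

(** Bounds on [beta_sq], its inverse and [beta_cross] hold on [K] by compactness,
    and [boundedness] turns them into a bound on [g]. *)
Lemma compact_preimage K : compact K -> K `<=` moment @` coad_orbit rho f ->
  compact (preimage_q rho f K).
Proof.
move=> Kc Kim.
have tso : t \in so := tor_so sP.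
have Kpos h : K h -> 0 < beta_sq h.
  move=> /Kim[_ /(orbitP hG sP)[g ->] <-].
  by rewrite moment_trform ?conj_rho_so // beta_sq_gt0.
have [C1 hC1] : exists C, forall h, K h -> `|beta_sq h| <= C.
  by apply: compact_fun_bounded => // h _; exact: beta_sq_continuous.
have [C2 hC2] : exists C, forall h, K h -> `|(beta_sq h)^-1| <= C.
  apply: compact_fun_bounded => // h; rewrite inE => Kh.
  apply: (@invr_fun_continuous_at _ (dual (subvs_of lp)) beta_sq).
    by rewrite gt_eqF // Kpos.
  exact: beta_sq_continuous.
(* One sum of squares bounds all the [beta_cross j] together. *)
have [C3 hC3] : exists C, forall h, K h -> `|\sum_j beta_cross j h ^+ 2| <= C.
  apply: compact_fun_bounded => // h _; apply: sum_continuous => j _.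
  by apply: mulr_fun_continuous; exact: beta_cross_continuous.
pose eps := (1 + `|C2|)^-1.
have eps0 : 0 < eps by rewrite invr_gt0 ltr_wpDr.
have [D hD] := boundedness sP (Num.max C1 (1 + C3)) eps0.
pose F g := g *m t *m ginv g.
have Fc : continuous F.
  apply: mulmx_continuous.
    by apply: mulmx_continuous; [move=> g; exact: cvg_id | exact: cst_continuous].
  have -> : @ginv R m = fun g => Imx R m *m g^T *m Imx R m.
    by apply/funext => g; rewrite ginv_def.
  apply: mulmx_continuous; last exact: cst_continuous.
  apply: mulmx_continuous; first exact: cst_continuous.
  by apply: trmx_continuous => g; exact: cvg_id.
pose Gam := [set g : 'M[R]_N | forall i j, `|g i j| <= D] `&`
  (@SOe R m `&` (fun g => trform lp (F g)) @^-1` K).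
have Gamc : compact Gam.
  apply: compact_closedI; first exact: mx_box_compact.
  apply: closedI; first exact: SOe_closed.
  apply: closed_comp; first by move=> g _; exact: trform_continuous.
  by apply: compact_closed => //; exact: dual_hausdorff.
suff -> : preimage_q rho f K = (fun g => trform so (F g)) @` Gam.
  apply: continuous_compact => //; apply: continuous_subspaceT.
  exact: trform_continuous.
apply/seteqP; split=> [_ [/(orbitP hG sP)[g ->]]|_ [x [_ [xS xK]] <-]].
  rewrite /preimage /= moment_trform ?conj_rho_so // => gK.
  have e : conj_rho rho g t = F (rho g) by rewrite /conj_rho rhoV.
  exists (rho g); last by rewrite -e iota_mx_trform ?conj_rho_so.
  split; last by split; [exact: rho_SOe | rewrite /preimage /= -e].
  have Aso : F (rho g) \in so by rewrite -e conj_rho_so.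
  rewrite e in gK; have b0 := Kpos _ gK.
  have := hC1 _ gK; have := hC2 _ gK; have := hC3 _ gK.
  rewrite beta_sq_trform // in b0 *; move=> h3 h2 h1 i j.
  apply: hD; rewrite -/(F (rho g)).
  - exact: rho_SOe.
  - rewrite /eps -[leRHS]invrK lef_pV2 ?posrE ?invr_gt0 ?ltr_wpDr //.
    by apply: le_trans (ler_norm _) _; apply: le_trans h2 _;
      rewrite (le_trans (ler_norm _)) // lerDr.
  - by apply: le_trans (ler_norm _) _; rewrite le_max h1.
  - move=> j'; rewrite le_max; apply/orP; right.
    rewrite -beta_cross_trform //; set y := beta_cross _ _.
    have : y ^+ 2 <= C3.
      apply: le_trans (le_trans (ler_norm _) h3).
      by rewrite (bigD1 j') //= lerDl sumr_ge0 // => k _; exact: sqr_ge0.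
    rewrite -real_normK ?num_real //.
    by have := sqr_ge0 (`|y| - 1); have := normr_ge0 y; nra.
have [g gE] := rho_surj hG xS.
have e : conj_rho rho g t = F x by rewrite /conj_rho rhoV // gE.
split; first by apply/(orbitP hG sP); exists g; rewrite iota_mx_trform ?conj_rho_so // e.
by rewrite /preimage /= -e -iota_mx_trform ?conj_rho_so // moment_trform ?conj_rho_so // e.
Qed.

Lemma weakly_proper : q_weakly_proper rho f.
Proof. by move=> K Kc Kim; apply: compact_preimage => // h /Kim[]. Qed.

Lemma tor_ilast i : t i ilast = 0 /\ t ilast i = 0.
Proof.
have sl : s ilast = 0 by apply/eqP; rewrite (s_eq0 sP).
split; rewrite mxE; last by rewrite sl mul0rn.
rewrite (eq_sigma sP) (sigma_last sP); case: eqP => [->|_]; last by rewrite mulr0n.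
by rewrite sl mul0rn.
Qed.

Lemma tor_skew : t^T = - t.
Proof.
apply/matrixP => i j; rewrite !mxE (eq_sigma sP).
by case: eqP => [->|_]; rewrite ?(s_sigma sP) ?mulr1n ?mulr0n ?oppr0.
Qed.

Local Notation x := (\row_j t (spa j) iprev).

(** The components of [t] in [m], [nbar] and [n]. *)
Lemma tor_decomp :
  t = upper_left (ulsubmx t) + 2^-1 *: (Xmx x)^T - 2^-1 *: Xmx x.
Proof.
have sk i j : t i j = - t j i.
  by have /matrixP /(_ j i) := tor_skew; rewrite mxE => ->; rewrite mxE.
have pp : t iprev iprev = 0 by have := sk iprev iprev => h; lra.
have xE j : x 0 j = t (spa j) iprev by rewrite mxE.
apply/matrixP => i j; rewrite addmxE oppmxE addmxE !scalemxE trmxE.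
case: (indexP i) => [[i' ->]|->|->]; case: (indexP j) => [[j' ->]|->|->];
  rewrite !XmxE !ulE ?xE ?pp ?(tor_ilast _).1 ?(tor_ilast _).2.
all: try by field.
  by rewrite [ulsubmx _ _ _]mxE [usubmx _ _ _]mxE /spa; ring.
by rewrite (sk iprev (spa j')); field.
Qed.

(** Along the boosts the moment images are on the segment [K] from the depth zero
    element given by the [m]-component of [t], while the value on [Y] of the
    conjugate grows like [exp u]. *)
Lemma not_proper : ~ q_proper rho f.
Proof.
move=> qp.
have tso : t \in so := tor_so sP.
pose B := ulsubmx t; pose Y : 'M[R]_N := (Xmx x)^T.
pose K := (fun r : R => trform lp (upper_left B + r *: Y)) @` `[0, 1]%classic.
have Kc : compact K.
  apply: continuous_compact; last exact: segment_compact.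
  apply: continuous_subspaceT; apply: trform_continuous; apply: mx_continuous => i j.
  have -> : (fun r : R => (upper_left B + r *: Y) i j) =
            (fun r : R => upper_left B i j + r * Y i j).
    by apply/funext => r; rewrite addmxE scalemxE.
  move=> r; apply: cvgD; first exact: cvg_cst.
  by apply: cvgM; [exact: cvg_id | exact: cvg_cst].
have Yso : Y \in so.
  apply/so_lorP => i j; rewrite ![Y _ _]mxE.
  by rewrite (so_lorP _ (Xmx_so x) j i) [msign j * _]mulrC.
have [C hC] : exists C, forall h : dual (subvs_of so), preimage_q rho f K h ->
    `|h (vsproj so Y) : R| <= C.
  by apply: compact_fun_bounded; [exact: qp | move=> h _; exact: eval_continuous].
pose X := \sum_j x 0 j ^+ 2.
have tv j : (t *m v) (spa j) 0 = x 0 j.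
  by rewrite mul_vnull (tor_ilast _).1 addr0 mxE.
have X0 : 0 < X.
  have := beta_sq_gt0 1%g; rewrite beta_sq_trform ?conj_rho_so //.
  rewrite /conj_rho invg1 !(rho1 hG) mul1mx mulmx1.
  by under eq_bigr do rewrite tv.
have trY : \tr (t *m Y) = - (2 * X).
  rewrite -mxtrace_tr trmx_mul trmxK tor_skew mulmxN linearN /= mxtrace_mulC.
  rewrite tr_mul_Xmx //; congr (- (_ * _)); apply: eq_bigr => j _.
  by rewrite tv expr2.
have key (u : R) : 0 <= u -> expR u * X <= C.
  move=> u0; have bS := boost_SOe u; have bO := boost_Omx (m := m) u.
  have [g gE] := rho_surj hG (boost_SOe (m := m) u).
  have cE (Z : 'M[R]_N) c : boost u *m Z = c *: (Z *m boost u) ->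
      boost u *m Z *m ginv (boost u) = c *: Z.
    by move=> ->; rewrite -scalemxAl -mulmxA mul_ginv // mulmx1.
  have AE : conj_rho rho g t = upper_left B + (2^-1 * expR (- u)) *: Y
                           + Xmx (- (2^-1 * expR u) *: x).
    rewrite /conj_rho rhoV // gE {1}tor_decomp mulmxBr mulmxDr mulmxBl mulmxDl.
    rewrite -!scalemxAr -!scalemxAl (cE _ _ (boost_Xmx u x)) (cE _ _ (boost_trXmx u x)).
    have := cE (upper_left B) 1; rewrite !scale1r => -> //; last exact: boost_ul.
    by rewrite !scalerA XmxZ scaleNr.
  have hin : preimage_q rho f K (iota_mx (conj_rho rho g t)).
    split; first by apply/(orbitP hG sP); exists g.
    rewrite /preimage /= moment_trform ?conj_rho_so // AE trform_Xmx.
    exists (2^-1 * expR (- u)) => //.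
    have e1 : expR (- u) <= 1 by rewrite -expR0 ler_expR oppr_le0.
    have e0 := expR_ge0 (- u).
    by rewrite /= in_itv /=; apply/andP; split; lra.
  have := hC _ hin; rewrite iota_mxE ?conj_rho_so // vsprojK //.
  have -> : \tr (conj_rho rho g t *m Y) = expR u * \tr (t *m Y).
    rewrite /conj_rho rhoV // gE -mulmxA.
    have -> : ginv (boost u) *m Y = expR u *: (Y *m ginv (boost u)).
      have := boost_trXmx u x; rewrite -/Y => bY.
      have : ginv (boost u) *m (boost u *m Y) *m ginv (boost u) =
             expR (- u) *: (ginv (boost u) *m Y).
        by rewrite bY -scalemxAr -scalemxAl -!mulmxA mul_ginv // mulmx1.
      rewrite mulmxA ginv_mul // mul1mx => ->.
      by rewrite scalerA mulrC expR_inv scale1r.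
    rewrite -scalemxAr linearZ /= mulmxA mxtrace_mulC !mulmxA.
    by rewrite ginv_mul // mul1mx.
  rewrite trY; have -> : 2^-1 * (expR u * - (2 * X)) = - (expR u * X) by field.
  by rewrite normrN ger0_norm // mulr_ge0 ?expR_ge0 // ltW.
have C0 : 0 <= C.
  by apply: le_trans (key 0 (lexx _)); rewrite mulr_ge0 ?expR_ge0 // ltW.
have := key (C / X); rewrite divr_ge0 ?(ltW X0) // => /(_ isT).
have := expR_ge1Dx (C / X); rewrite -(ler_pM2r X0) mulrDl divfK ?gt_eqF // mul1r.
by move=> h1 h2; have := le_trans h1 h2; lra.
Qed.

End Moment.

(** * The element [t] of the theorem *)

Section TorusElement.
Context {R : realType} {n : nat}.
Hypothesis n_gt0 : (0 < n)%N.
Local Notation m := (2 * n - 1)%N.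
Local Notation N := (m + (1 + 1))%N.
Variable a : 'I_n -> R.

(** Extended by zero, so that the timelike index [2 * n] gets weight zero. *)
Definition anat (k : nat) : R := if insub k is Some j then a j else 0.

Lemma anat_ord (j : 'I_n) : anat j = a j.
Proof. by rewrite /anat valK. Qed.

Lemma anat_out k : (n <= k)%N -> anat k = 0.
Proof. by move=> nk; rewrite /anat insubF // ltnNge nk. Qed.

(* At the last index [2 * n] the successor is out of range, and [insubd] returns
   the index itself. *)
Definition t_sigma (i : 'I_N) : 'I_N := insubd i (if odd i then i.-1 else i.+1).

Definition t_weight (i : 'I_N) : R :=
  if odd i then - anat i./2 else anat i./2.

Lemma t_sigma_val (i : 'I_N) :
  t_sigma i = (if odd i then i.-1 else if (i < 2 * n)%N then i.+1 else i) :> nat.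
Proof.
rewrite /t_sigma val_insubd; have := ltn_ord i.
move=> iN; case: (boolP (odd i)) => io.
  by have -> : (i.-1 < N)%N by lia.
have [i2n|i2n] := ltnP i (2 * n); first by have -> : (i.+1 < N)%N by lia.
by have -> : (i.+1 < N)%N = false by lia.
Qed.

Lemma ilast_val : @ilast m = (2 * n)%N :> nat.
Proof. by rewrite /=; lia. Qed.

Lemma t_mx_tor : t_mx m a = tor t_weight t_sigma.
Proof.
apply/matrixP => i j; rewrite !mxE.
have jE : (j == t_sigma i) = (j == t_sigma i :> nat) by [].
have iN := ltn_ord i; have jN := ltn_ord j.
rewrite jE t_sigma_val /t_weight.
have [i2n|i2n] := ltnP i (2 * n); last first.
  rewrite big1 => [|k _].
    have a0 : anat i./2 = 0 by apply: anat_out; lia.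
    by rewrite a0 oppr0; case: ifP => _; rewrite mul0rn.
  have kn := ltn_ord k.
  have -> : (i == k.*2 :> nat) = false by apply/eqP; lia.
  have -> : (i == k.*2.+1 :> nat) = false by apply/eqP; lia.
  by rewrite subrr mulr0.
have i2 : (i./2 < n)%N by lia.
rewrite (bigD1 (Ordinal i2)) //= big1 => [|k /eqP kne]; last first.
  have kne' : k <> i./2 :> nat by move=> e; apply: kne; apply: val_inj.
  have -> : (i == k.*2 :> nat) = false by apply/eqP; lia.
  have -> : (i == k.*2.+1 :> nat) = false by apply/eqP; lia.
  by rewrite subrr mulr0.
rewrite addr0 -(anat_ord (Ordinal i2)) /=.
case: ifP => io.
  have -> : (i == i./2.*2 :> nat) = false by apply/eqP; lia.
  have -> : (i == i./2.*2.+1 :> nat) = true by apply/eqP; lia.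
  have -> : (j == i./2.*2 :> nat) = (j == i.-1 :> nat) by apply/eqP/eqP; lia.
  by rewrite /= sub0r mulrN mulr_natr mulNrn.
have -> : (i == i./2.*2.+1 :> nat) = false by apply/eqP; lia.
have -> : (i == i./2.*2 :> nat) = true by apply/eqP; lia.
have -> : (j == i./2.*2.+1 :> nat) = (j == i.+1 :> nat) by apply/eqP/eqP; lia.
by rewrite /= subr0 mulr_natr.
Qed.

Hypothesis a_decr : forall i j : 'I_n, (i < j)%N -> (j < n.-1)%N -> a j < a i.
Hypothesis a_last : forall i j : 'I_n, (i < j)%N -> j = n.-1 :> nat -> `|a j| < a i.
Hypothesis a_neq0 : forall j : 'I_n, j = n.-1 :> nat -> 0 < `|a j|.

(** The absolute values decrease strictly, including the value zero at [n]; this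
    is the regularity of [t]. *)
Lemma anat_decr k l : (k < l <= n)%N -> `|anat l| < `|anat k|.
Proof.
move=> /andP[kl ln]; have kn : (k < n)%N by lia.
have nn : (n.-1 < n)%N by lia.
pose K := Ordinal kn; pose T := Ordinal nn.
have aK : anat k = a K by rewrite -(anat_ord K).
have pos (i : 'I_n) : (i < n.-1)%N -> 0 < a i.
  by move=> i_lt; have := @a_last i T i_lt erefl; exact: le_lt_trans (normr_ge0 _).
have [lE|l_ne] := eqVneq l n.
  rewrite lE anat_out // normr0 aK; have [kT|kT] := eqVneq k n.-1.
    exact: a_neq0.
  by rewrite normr_gt0 gt_eqF // pos //=; lia.
have l_lt : (l < n)%N by lia.
have -> : anat l = a (Ordinal l_lt) by rewrite -(anat_ord (Ordinal l_lt)).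
have kpos : 0 < a K by apply: pos => /=; lia.
rewrite aK (ger0_norm (ltW kpos)).
have [lT|lT] := eqVneq l n.-1; first exact: a_last.
have lT' : (l < n.-1)%N by lia.
by rewrite ger0_norm ?(ltW (pos _ _)) // a_decr.
Qed.

Lemma t_weight_norm i : `|t_weight i| = `|anat i./2|.
Proof. by rewrite /t_weight; case: ifP; rewrite ?normrN. Qed.

Lemma paired_t : paired t_weight t_sigma.
Proof.
have lastP (i : 'I_N) : (i == ilast) = (i == (2 * n)%N :> nat).
  by apply/eqP/eqP => [->|h]; [exact: ilast_val | apply: val_inj => /=; lia].
split=> [i|i|i|i j].
- apply: val_inj => /=; rewrite !t_sigma_val; have := ltn_ord i.
  by case: (boolP (odd i)) => io; repeat case: ifP; lia.
- rewrite /t_weight !t_sigma_val; have iN := ltn_ord i.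
  have [i2n|i2n] := ltnP i (2 * n); last first.
    have a0 (k : nat) : (2 * n <= k)%N -> anat k./2 = 0.
      by move=> nk; apply: anat_out; lia.
    have io : odd i = false by lia.
    by rewrite io a0 ?oppr0 //; case: ifP.
  have -> : (if odd i then i.-1 else i.+1)./2 = i./2 by case: ifP; lia.
  have -> : odd (if odd i then i.-1 else i.+1) = ~~ odd i by case: ifP; lia.
  by case: (odd i); rewrite ?opprK.
- rewrite lastP -normr_eq0 t_weight_norm; have iN := ltn_ord i.
  apply/idP/eqP => [h|->]; last by rewrite anat_out ?normr0 //; lia.
  have [|i2] := leqP n i./2; first by lia.
  by have := @anat_decr i./2 n; rewrite (eqP h) i2 leqnn normr_lt0 => /(_ isT).
- move=> e; have : `|t_weight j| = `|t_weight i| by rewrite -!sqrtr_sqr e.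
  rewrite !t_weight_norm => {}e; have iN := ltn_ord i; have jN := ltn_ord j.
  have ij : i./2 = j./2.
    have [h|h|//] := ltngtP i./2 j./2.
      by have := @anat_decr i./2 j./2; rewrite e ltxx h => /(_ ltac:(lia)).
    by have := @anat_decr j./2 i./2; rewrite e ltxx h => /(_ ltac:(lia)).
  have [->|ji] := eqVneq j i; [by left | right].
  apply: val_inj; rewrite /= t_sigma_val; move: ji; rewrite -val_eqE /=.
  by case: ifP => io; [|case: ifP => i2n]; lia.
Qed.

End TorusElement.

Theorem proposition4p12 (R : realType) (n : nat) (hn : (2 <= n)%N)
  (G : topGroupType) (rho : G -> 'M[R]_((2 * n - 1) + (1 + 1)))
  (hG : is_spin rho)
  (a : 'I_n -> R)
  (ha_decr : forall i j : 'I_n, (i < j)%N -> (j < n.-1)%N -> a j < a i)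
  (ha_last : forall i j : 'I_n, (i < j)%N -> j = n.-1 :> nat -> `|a j| < a i)
  (ha_neq0 : forall j : 'I_n, j = n.-1 :> nat -> 0 < `|a j|) :
  let f := f_elt (2 * n - 1) a in
  [/\ moment @` coad_orbit rho f `<=` [set h | depth_one h],
      (forall g : G,
         exists orb, reduced_space rho f (moment (coAd rho g f)) = [set orb]),
      q_weakly_proper rho f
    & ~ q_proper rho f].
Proof.
have n0 : (0 < n)%N by lia.
have sP := paired_t n0 ha_decr ha_last ha_neq0.
have -> : f_elt (2 * n - 1) a = iota_mx (tor (t_weight a) (@t_sigma n)).
  by rewrite -(t_mx_tor n0).
move=> f; split.
- exact: (image_depth_one hG sP).
- exact: (reduced_space_singleton hG sP).
- exact: (weakly_proper hG sP).
- exact: (not_proper hG sP).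
Qed.
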